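(* Consider the random graph process $(G_t(n))_{t=0}^{\binom n2}$. Let $\tau_{\mathcal N}$ be the smallest $t$ such that $G_t(n)$ is connected and has no NAC-colouring, and let $\tau_{\mathcal T}$ be the smallest $t$ such that every vertex of $G_t(n)$ lies in a triangle. Then asymptotically almost surely $\tau_{\mathcal N}=\tau_{\mathcal T}$.
   Context: The random graph process starts with $G_0(n)$ the empty graph on $n$ vertices, and for each $t\ge1$, $G_t(n)$ is obtained from $G_{t-1}(n)$ by adding an edge chosen uniformly at random among the non-edges of $G_{t-1}(n)$, independently of previous choices. A NAC-colouring of a graph $G$ is a surjective map $E(G)\to\{\text{red},\text{blue}\}$ such that no cycle of $G$ contains exactly one red edge or exactly one blue edge. (The property of being connected with no NAC-colouring is monotone under adding edges, so $G_t(n)$ has it iff $t\ge\tau_{\mathcal N}$.) ''Asymptotically almost surely'' means with probability tending to $1$ as $n\to\infty$. *)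

(* Defs.v *)
From HB Require Import structures.
From mathcomp Require Import all_boot all_order all_algebra.
From mathcomp Require Import boolp reals.

Set Implicit Arguments.
Unset Strict Implicit.
Unset Printing Implicit Defensive.

Import Order.TTheory GRing.Theory Num.Theory.

Local Open Scope ring_scope.

Section Graphs.
Variable T : finType.

(* The pairs of distinct vertices, i.e. the edges of the complete graph on T.
   A simple graph with vertex set T is a value of type {set edge T}. *)
Definition edge : finType := {e : {set T} | #|e| == 2}.

Implicit Type G : {set edge}.

(* Irreflexive, since [set x; x] has only one element. *)
Definition adj G : rel T :=
  fun x y => [exists e : edge, (e \in G) && (val e == [set x; y])].

Definition connected G : Prop := forall x y : T, connect (adj G) x y.

Definition in_triangle G (x : T) : Prop :=
  exists y z : T, [/\ adj G x y, adj G y z & adj G z x].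

Definition all_in_triangle G : Prop := forall x : T, in_triangle G x.

Definition edge_of G : finType := {e : edge | e \in G}.

(* A cycle is given by the list of its vertices, in cyclic order. *)
Definition is_cycle G (s : seq T) : bool :=
  [&& (2 < size s)%N, uniq s & cycle (adj G) s].

Definition cycle_edges G (s : seq T) : {set edge_of G} :=
  [set e | [exists x : T, (x \in s) && (val (val e) == [set x; next s x])]].

(* The two colours are the booleans: true is red, false is blue. *)
Definition NAC_colouring G (c : edge_of G -> bool) : Prop :=
  (forall k : bool, exists e, c e = k) /\
  (forall s, is_cycle G s ->
   forall k : bool, #|[set e in cycle_edges G s | c e == k]| <> 1%N).

Definition has_NAC_colouring G : Prop :=
  exists c : edge_of G -> bool, NAC_colouring c.

Definition connected_no_NAC G : Prop :=
  connected G /\ ~ has_NAC_colouring G.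

End Graphs.

Section Process.
Variable n : nat.

(* An outcome of the process: w i is the edge added at step i + 1. *)
Definition outcome : finType := {ffun 'I_('C(n, 2)) -> edge 'I_n}.

Implicit Type w : outcome.

(* The graph G_t(n). *)
Definition process w (t : nat) : {set edge 'I_n} :=
  [set w i | i : 'I_('C(n, 2)) & (i < t)%N].

(* The least t <= 'C(n, 2) such that G_t(n) satisfies P; by convention it is
   'C(n, 2) + 1 if there is none, which for the properties below only happens
   when n < 3. *)
Definition hitting_time (P : {set edge 'I_n} -> Prop) w : nat :=
  find (fun t => `[< P (process w t) >]) (iota 0 ('C(n, 2)).+1).

Definition tau_NAC : outcome -> nat := hitting_time (@connected_no_NAC 'I_n).

Definition tau_triangle : outcome -> nat :=
  hitting_time (@all_in_triangle 'I_n).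

Variable R : realType.

Definition uniform_mass (S : finType) (A : {set S}) (x : S) : R :=
  (x \in A)%:R / #|A|%:R.

(* By the chain rule: given the first i edges, the next one is uniform on the
   set of non-edges of the current graph. *)
Definition outcome_mass w : R :=
  \prod_(i < 'C(n, 2)) uniform_mass (~: process w i) (w i).

Definition Pr (A : pred outcome) : R := \sum_(w | A w) outcome_mass w.

End Process.

(* Main.v *)
(* A NAC-colouring maps the vertices to a grid (red component, blue component)
   in which every edge stays within exactly one row or one column.

   A connected graph on at least three vertices without NAC-colouring has every
   vertex in a triangle, since otherwise colouring the edges at a vertex red and
   the others blue is a NAC-colouring (a star is treated apart). So tau_T <= tau_N
   holds surely.

   Conversely let G be the graph at time tau_T. If G is disconnected or has a
   NAC-colouring then, as two sets of linear size are joined by an edge, one row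
   or column (or one connected component) misses only a small nonempty set U, and
   no triangle of G has exactly one vertex in U. Each vertex of U lies in a
   triangle, hence has a neighbour in U. With |U| = k this costs, in the union
   bound, a factor n^k for the choice of U, (k p^(1/2))^k for the k / 2 edges
   inside U, and n^(- c k) for the absence, slightly before tau_T, of triangles
   with exactly one vertex in U (Janson's inequality), where c < 1 is close to 1
   and p = n^(- 2/3 + o(1)). The sum over k is o(1); for large k the second
   factor is not needed.

   The times slightly before and after the threshold are compared with product
   measures, in which a second moment computation and Janson's inequality show
   that tau_T lies between them. *)
Require Import Defs.
From HB Require Import structures.
From mathcomp Require Import all_boot all_order all_algebra.
From mathcomp Require Import boolp reals sequences exp.
From mathcomp Require Import zify ring lra.
Set Implicit Arguments.
Unset Strict Implicit.
Unset Printing Implicit Defensive.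
Import Order.TTheory GRing.Theory Num.Theory.
Local Open Scope ring_scope.

(** * Product measures and Janson's inequality *)

(** The two fixed times enclosing tau_T lie at densities a constant factor apart. This wide window
    keeps the comparison with product measures crude: every event involved is monotone, so it is
    enough that the edge counts fall on the correct side with probability at least 1/2, which
    Chebyshev gives at the price of a factor 2. The cost of the width is that the absence of
    triangles with exactly one vertex in U is only worth n^(- 23k/25) at the earlier time, short of
    the n^k choices of U; this deficit is what brings in the edges inside U. Those edges are only
    known to exist at the later time, so the pair of graphs at both times is modelled jointly by two
    independent rounds. The event about U is decreasing in the earlier graph and increasing in the
    later one, and Harris' inequality bounds the probability of both requirements by a product. *)

Lemma preimset_id (T : finType) (w : {set T}) : id @^-1: w = w.
Proof. by apply/setP => e; rewrite inE. Qed.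

Lemma set_ind (T : finType) (P : {set T} -> Prop) :
  P set0 -> (forall x (A : {set T}), x \notin A -> P A -> P (x |: A)) -> forall A, P A.
Proof.
move=> P0 PS A; elim: {A}#|A| {-2}A (erefl #|A|) => [|k IH] A.
  by move/cards0_eq->.
move=> Ak; have /card_gt0P[x xA] : (0 < #|A|)%N by rewrite Ak.
rewrite -(setD1K xA); apply: PS; first by rewrite !inE eqxx.
by apply: IH; move: Ak; rewrite (cardsD1 x) xA; case.
Qed.

Section ProductMeasure.
Variables (R : realFieldType) (I : finType) (p : I -> R).
Hypotheses (p_ge0 : forall i, 0 <= p i) (p_le1 : forall i, p i <= 1).
Implicit Types (w f : {set I}) (Q D : pred {set I}).

Definition mass w : R := \prod_i (if i \in w then p i else 1 - p i).
Definition prob Q : R := \sum_(w | Q w) mass w.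
Definition weight f : R := \prod_(i in f) p i.

Lemma mass_ge0 w : 0 <= mass w.
Proof. by apply: prodr_ge0 => i _; case: ifP => _; rewrite ?subr_ge0. Qed.

Lemma sum_mass : \sum_w mass w = 1.
Proof.
rewrite -(bigA_distr _ _ p (fun i => 1 - p i)) big1 // => i _.
by rewrite /= addrC subrK.
Qed.

Lemma prob_ge0 Q : 0 <= prob Q.
Proof. by apply: sumr_ge0 => w _; apply: mass_ge0. Qed.

Lemma le_prob Q D : (forall w, Q w -> D w) -> prob Q <= prob D.
Proof.
move=> QD; rewrite /prob [leRHS](bigID Q) /= -[leLHS]addr0 lerD //.
  rewrite le_eqVlt; apply/orP; left; apply/eqP/eq_bigl => w.
  by case: (boolP (Q w)) => [/QD->|]; rewrite ?andbF.
by apply: sumr_ge0 => w _; apply: mass_ge0.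
Qed.

Lemma eq_prob Q D : Q =1 D -> prob Q = prob D.
Proof. exact: eq_bigl. Qed.

Lemma probT Q : (forall w, Q w) -> prob Q = 1.
Proof. by move=> QT; rewrite -sum_mass; apply: eq_bigl. Qed.

Lemma probID D Q :
  prob Q = prob (fun w => Q w && D w) + prob (fun w => Q w && ~~ D w).
Proof. exact: bigID. Qed.

Lemma probC Q : prob (fun w => ~~ Q w) = 1 - prob Q.
Proof. by rewrite -(@probT xpredT) // (probID Q xpredT) /= addrC addKr. Qed.

Lemma prob_sum (K : finType) (P : pred K) (A : K -> pred {set I}) Q :
  (forall w, Q w -> exists2 k, P k & A k w) ->
  prob Q <= \sum_(k | P k) prob (A k).
Proof.
move=> QA; under eq_bigr do rewrite /prob big_mkcond /=.
rewrite exchange_big /= /prob big_mkcond /=; apply: ler_sum => w _.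
have sum_ge0 (P' : pred K) : 0 <= \sum_(k | P' k) (if A k w then mass w else 0).
  by apply: sumr_ge0 => k _; case: ifP; rewrite ?mass_ge0.
case: ifP => // Qw; have [k Pk Akw] := QA w Qw.
by rewrite (bigD1 k) //= Akw lerDl.
Qed.

(** Presence of [i] is independent of the other coordinates, and [Q (i |: w)] depends only on those:
    both sides are [p i] times the common sum [s]. *)
Lemma prob_mem i Q :
  prob (fun w => (i \in w) && Q w) = p i * prob (fun w => Q (i |: w)).
Proof.
pose rest w : R := \prod_(j | j != i) (if j \in w then p j else 1 - p j).
have massE w : mass w = (if i \in w then p i else 1 - p i) * rest w.
  by rewrite /mass (bigD1 i).
have restE w : rest (i |: w) = rest w.
  by apply: eq_bigr => j ji; rewrite in_setU1 (negbTE ji).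
pose s := \sum_(w : {set I} | (i \in w) && Q w) rest w.
have -> : prob (fun w => (i \in w) && Q w) = p i * s.
  rewrite mulr_sumr; apply: eq_bigr => w /andP[iw _].
  by rewrite massE iw.
congr (_ * _); rewrite /prob (bigID (fun w : {set I} => i \in w)) /=.
have -> : \sum_(w | Q (i |: w) && (i \in w)) mass w = p i * s.
  rewrite mulr_sumr; apply: eq_big => [w|w /andP[_ iw]]; last first.
    by rewrite massE iw.
  by rewrite andbC; case: (boolP (i \in w)) => //= iw; rewrite (setUidPr _) ?sub1set.
have -> : \sum_(w | Q (i |: w) && (i \notin w)) mass w = (1 - p i) * s.
  rewrite mulr_sumr.
  rewrite [RHS](reindex_onto (fun w : {set I} => i |: w) (fun w => w :\ i)) /=; last first.
    by move=> w /andP[iw _]; rewrite setD1K.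
  apply: eq_big => [w|w /andP[_ iw]]; last first.
    by rewrite massE (negbTE iw) restE.
  rewrite setU11 /=; congr (_ && _).
  apply/idP/eqP => [iw|<-]; first by rewrite setU1K.
  by rewrite !inE eqxx.
by rewrite mulrBl mul1r addrC subrK.
Qed.

Lemma weight0 : weight set0 = 1.
Proof. by rewrite /weight big_set0. Qed.

Lemma weightU1 i f : i \notin f -> weight (i |: f) = p i * weight f.
Proof. by move=> fi; rewrite /weight big_setU1. Qed.

Lemma weight_ge0 f : 0 <= weight f.
Proof. by apply: prodr_ge0. Qed.

Lemma weight_le1 f : weight f <= 1.
Proof. by apply: prodr_ile1 => i _; rewrite p_ge0 p_le1. Qed.

Lemma weightU f g : weight (f :|: g) = weight f * weight (g :\: f).
Proof.
rewrite /weight (big_setID f) /= setUK; congr (_ * _).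
by rewrite setDUl setDv set0U.
Qed.

Lemma prob_subsetU1 i f Q : i \notin f ->
  prob (fun w => (i |: f \subset w) && Q w) =
  p i * prob (fun w => (f \subset w) && Q (i |: w)).
Proof.
move=> fi.
rewrite (@eq_prob _ (fun w => (i \in w) && ((f \subset w) && Q w))); last first.
  by move=> w; rewrite subUset sub1set andbA.
rewrite (prob_mem i (fun w => (f \subset w) && Q w)); congr (_ * _).
apply: eq_prob => w /=; congr (_ && _); apply/subsetP/subsetP => fw j fj.
  by have := fw j fj; rewrite in_setU1; case: eqP => // ji; rewrite -ji fj in fi.
by rewrite in_setU1 (fw j fj) orbT.
Qed.

Lemma prob_subset_indep f Q :
  (forall i w, i \in f -> Q (i |: w) = Q w) ->
  prob (fun w => (f \subset w) && Q w) = weight f * prob Q.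
Proof.
elim/set_ind: f => [|i f fi IH] Qf.
  by rewrite weight0 mul1r; apply: eq_prob => w; rewrite sub0set.
rewrite weightU1 // -mulrA -IH; last first.
  by move=> j w fj; rewrite Qf // in_setU1 fj orbT.
rewrite prob_subsetU1 //; congr (_ * _); apply: eq_prob => w.
by rewrite Qf // setU11.
Qed.

Lemma prob_subset f : prob (fun w => f \subset w) = weight f.
Proof.
rewrite -[RHS]mulr1 -(@probT xpredT) // -prob_subset_indep //.
by apply: eq_prob => w; rewrite andbT.
Qed.

(** Harris' inequality for the increasing event [f \subset w] and a decreasing [D]: forcing one more
    element into [w] can only destroy [D]. *)
Lemma prob_subset_antitone f D :
  (forall i w, D (i |: w) -> D w) ->
  prob (fun w => (f \subset w) && D w) <= weight f * prob D.
Proof.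
move=> Danti; elim/set_ind: f => [|i f fi IH].
  by rewrite weight0 mul1r le_prob // => w /andP[].
rewrite weightU1 // prob_subsetU1 // -mulrA ler_wpM2l //.
apply: le_trans IH; apply: le_prob => w /andP[fw Dw].
by rewrite fw; apply: Danti Dw.
Qed.

Section Avoid.
Variables (K : finType) (F : K -> {set I}).
Implicit Types L : {set K}.

Definition avoids L w : bool := [forall k in L, ~~ (F k \subset w)].

Lemma avoids_antitone L i w : avoids L (i |: w) -> avoids L w.
Proof.
move=> /forall_inP LF; apply/forall_inP => k kL; apply: contra (LF k kL).
by move/subset_trans; apply; apply: subsetUr.
Qed.

Lemma avoidsU1 k L w : avoids (k |: L) w = ~~ (F k \subset w) && avoids L w.
Proof.
apply/forall_inP/andP => [LF|[kw /forall_inP LF] l].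
  split; first by apply: LF; rewrite setU11.
  by apply/forall_inP => l lL; apply: LF; rewrite in_setU1 lL orbT.
by rewrite in_setU1 => /orP[/eqP->//|/LF].
Qed.

Lemma prob_avoidsU1 k L :
  prob (avoids (k |: L)) =
  prob (avoids L) - prob (fun w => (F k \subset w) && avoids L w).
Proof.
rewrite (probID (fun w => F k \subset w) (avoids L)).
have -> : prob (fun w => (F k \subset w) && avoids L w) =
    prob (fun w => avoids L w && (F k \subset w)).
  by apply: eq_prob => w; rewrite andbC.
by rewrite addrAC subrr add0r; apply: eq_prob => w; rewrite avoidsU1 andbC.
Qed.

Lemma prob_avoids0 : prob (avoids set0) = 1.
Proof. by apply: probT => w; apply/forall_inP => k; rewrite inE. Qed.

(** By Harris' inequality, avoiding [L] makes the presence of [F k] no more likely. *)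
Lemma prob_avoids_ge L : \prod_(k in L) (1 - weight (F k)) <= prob (avoids L).
Proof.
elim/set_ind: L => [|k L kL IH]; first by rewrite big_set0 prob_avoids0.
rewrite big_setU1 //= prob_avoidsU1.
apply: (@le_trans _ _ ((1 - weight (F k)) * prob (avoids L))).
  by rewrite ler_wpM2l // subr_ge0 weight_le1.
rewrite mulrBl mul1r lerB // prob_subset_antitone // => i w.
exact: avoids_antitone.
Qed.

(* Janson's inequality, from the conditional bound: given that the sets disjoint from [F k]
   are avoided, [F k] is still present with probability [weight (F k)]. *)
Lemma prob_avoids_le (d : R) L :
  d <= 1 ->
  (forall k, k \in L ->
    \sum_(l in L | (l != k) && ~~ [disjoint F l & F k]) weight (F l :\: F k)
      <= d) ->
  prob (avoids L) <= \prod_(k in L) (1 - (1 - d) * weight (F k)).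
Proof.
move=> d1; elim/set_ind: L => [|k L kL IH] Ld.
  by rewrite big_set0 prob_avoids0.
have {}IH : prob (avoids L) <= \prod_(k in L) (1 - (1 - d) * weight (F k)).
  apply: IH => l lL; apply: le_trans (Ld l _); last by rewrite in_setU1 lL orbT.
  rewrite [leRHS]big_mkcond [leLHS]big_mkcond /=; apply: ler_sum => j _.
  by rewrite in_setU1; case: (j \in L); rewrite ?orbT //; case: ifP => //; rewrite weight_ge0.
have d0 : 0 <= d.
  by apply: le_trans (Ld k (setU11 _ _)); apply: sumr_ge0 => l _; apply: weight_ge0.
rewrite big_setU1 //= prob_avoidsU1.
pose far := [set l in L | [disjoint F l & F k]].
pose near := [set l in L | ~~ [disjoint F l & F k]].
have sub_far w : avoids L w -> avoids far w.
  move=> /forall_inP Lw; apply/forall_inP => l; rewrite inE => /andP[lL _].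
  exact: Lw.
have far_indep f : f = F k ->
    prob (fun w => (f \subset w) && avoids far w) = weight f * prob (avoids far).
  move=> ->; apply: prob_subset_indep => i w iFk.
  apply/idP/idP; first exact: avoids_antitone.
  move=> /forall_inP Lw; apply/forall_inP => l lf; apply: contra (Lw l lf).
  move=> /subsetP sub; apply/subsetP => j jFl; have := sub j jFl.
  rewrite in_setU1 => /orP[/eqP ji|//]; move: lf; rewrite inE => /andP[_].
  by move=> /pred0P/(_ i) /=; rewrite -{1}ji jFl iFk.
(* If [F k] is present and [far] is avoided, then either all of [L] is avoided or some [near] set is
   present as well; the second case is a union bound combined with Harris' inequality. *)
have split_far : weight (F k) * prob (avoids far) <=
    prob (fun w => (F k \subset w) && avoids L w) +
    \sum_(l in near) weight (F k :|: F l) * prob (avoids far).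
  rewrite -far_indep //.
  rewrite (probID (avoids L)); apply: lerD.
    by apply: le_prob => w /andP[/andP[-> _] ->].
  apply: (@le_trans _ _ (\sum_(l in near)
      prob (fun w => (F k :|: F l \subset w) && avoids far w))).
    apply: prob_sum => w /andP[/andP[Fkw far_w]].
    rewrite negb_forall_in => /exists_inP[l lL]; rewrite negbK => Flw.
    exists l; last by rewrite subUset Fkw Flw far_w.
    rewrite inE lL /=; apply/negP => dis; move/forall_inP: far_w.
    by move=> /(_ l); rewrite inE lL dis Flw => /(_ isT).
  by apply: ler_sum => l _; apply: prob_subset_antitone => i w; apply: avoids_antitone.
have near_le : \sum_(l in near) weight (F k :|: F l) * prob (avoids far) <=
    d * weight (F k) * prob (avoids far).
  rewrite -mulr_suml ler_wpM2r ?prob_ge0 //.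
  under eq_bigr do rewrite weightU.
  rewrite -mulr_sumr mulrC ler_wpM2r ?weight_ge0 //.
  apply: le_trans (Ld k (setU11 _ _)); rewrite le_eqVlt; apply/orP; left.
  apply/eqP/eq_bigl => l; rewrite !inE; case: eqVneq => [->|] //=.
  by rewrite (negbTE kL).
have far_ge : prob (avoids L) <= prob (avoids far) by apply: le_prob.
have ge_k : (1 - d) * weight (F k) * prob (avoids L) <=
    prob (fun w => (F k \subset w) && avoids L w).
  apply: (@le_trans _ _ ((1 - d) * weight (F k) * prob (avoids far))).
    by rewrite ler_wpM2l // mulr_ge0 ?weight_ge0 ?subr_ge0.
  rewrite mulrBl mul1r mulrBl lerBlDr; apply: le_trans split_far _.
  by rewrite lerD2l.
apply: (@le_trans _ _ ((1 - (1 - d) * weight (F k)) * prob (avoids L))).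
  by rewrite mulrBl mul1r lerB.
rewrite ler_wpM2l // subr_ge0.
by rewrite mulr_ile1 ?weight_ge0 ?weight_le1 ?subr_ge0 // lerBlDr lerDl.
Qed.

End Avoid.

Section Count.
Variables (K : finType) (A : K -> pred {set I}).

(** Chebyshev's inequality around a centre [c]: the right side is the expanded second moment of the
    count minus [c]. *)
Lemma prob_deviation (c d : R) (Q : pred {set I}) :
  0 <= d ->
  (forall w, Q w -> d <= `|(\sum_k A k w)%:R - c|) ->
  prob Q * d ^+ 2 <=
    \sum_k \sum_l prob (fun w => A k w && A l w) -
    2 * c * \sum_k prob (A k) + c ^+ 2.
Proof.
move=> d0 Qd; pose X w : R := (\sum_k A k w)%:R.
have XE w : X w = \sum_k (A k w)%:R by rewrite /X natr_sum.
have probE Z : prob Z = \sum_w mass w * (Z w)%:R.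
  rewrite /prob big_mkcond; apply: eq_bigr => w _.
  by case: ifP => _; rewrite ?mulr1 ?mulr0.
have E1 : \sum_k prob (A k) = \sum_w mass w * X w.
  under eq_bigr do rewrite probE; rewrite exchange_big /=.
  by apply: eq_bigr => w _; rewrite XE mulr_sumr.
have E2 : \sum_k \sum_l prob (fun w => A k w && A l w) = \sum_w mass w * X w ^+ 2.
  under eq_bigr do under eq_bigr do rewrite probE.
  rewrite pair_big exchange_big /=; apply: eq_bigr => w _.
  rewrite XE expr2 big_distrlr /= pair_big mulr_sumr; apply: eq_bigr => -[k l] _ /=.
  by rewrite -natrM mulnb.
have -> : c ^+ 2 = \sum_w mass w * c ^+ 2 by rewrite -mulr_suml sum_mass mul1r.
rewrite E1 E2 mulr_sumr -sumrB -big_split /=.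
rewrite probE mulr_suml; apply: ler_sum => w _.
have -> : mass w * X w ^+ 2 - 2 * c * (mass w * X w) + mass w * c ^+ 2 =
  mass w * (X w - c) ^+ 2 by ring.
rewrite -mulrA ler_wpM2l ?mass_ge0 //; case: (boolP (Q w)) => [/Qd|_]; last first.
  by rewrite mul0r sqr_ge0.
by rewrite mul1r -/(X w) => dX; rewrite -[leRHS]real_normK ?num_real // ler_sqr ?nnegrE.
Qed.
End Count.
End ProductMeasure.

(** * NAC-colourings, triangles and large monochromatic components *)

Section Triangles.
Variable T : finType.
Implicit Types (G H A : {set edge T}) (S U : {set T}) (x y z : T).

Definition clique S : {set edge T} := [set e : edge T | val e \subset S].

Definition triangle G S : bool := (#|S| == 3%N) && (clique S \subset G).

Lemma adjP G x y :
  reflect (exists2 e, e \in G & val e = [set x; y]) (adj G x y).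
Proof.
apply: (iffP existsP) => [[e /andP[eG /eqP exy]]|[e eG exy]]; exists e => //.
by rewrite eG exy eqxx.
Qed.

Lemma edge_neq (e : edge T) x y : val e = [set x; y] -> x != y.
Proof. by move=> exy; have := valP e; rewrite exy cards2; case: (x != y). Qed.

Lemma edge_ends (e : edge T) : exists x y, val e = [set x; y].
Proof. by have /cards2P[x [y [_ exy]]] := valP e; exists x, y. Qed.

Lemma edge_exists x y : x != y -> exists e : edge T, val e = [set x; y].
Proof.
move=> xy; have xy2 : #|[set x; y]| == 2 by rewrite cards2 xy.
by exists (Sub [set x; y] xy2).
Qed.

Lemma adj_sym G x y : adj G x y = adj G y x.
Proof. by rewrite /adj; under eq_existsb do rewrite setUC. Qed.

Lemma adj_neq G x y : adj G x y -> x != y.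
Proof. by case/adjP=> e _ /edge_neq. Qed.

Lemma adj_mono G H x y : G \subset H -> adj G x y -> adj H x y.
Proof. by move=> /subsetP GH /adjP[e /GH eH exy]; apply/adjP; exists e. Qed.

Lemma triangle_adj G S x y :
  triangle G S -> x \in S -> y \in S -> x != y -> adj G x y.
Proof.
move=> /andP[_ /subsetP SG] xS yS xy; have [e exy] := edge_exists xy.
apply/adjP; exists e => //; apply: SG.
by rewrite inE exy subUset !sub1set xS yS.
Qed.

Lemma triangle_mono G H S : G \subset H -> triangle G S -> triangle H S.
Proof. by move=> GH /andP[S3 SG]; rewrite /triangle S3 (subset_trans SG). Qed.

Lemma in_triangleP G x :
  in_triangle G x <-> exists2 S : {set T}, x \in S & triangle G S.
Proof.
split=> [[y [z [xy yz zx]]]|[S xS SG]].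
  have [[nxy nyz] nzx] := (adj_neq xy, adj_neq yz, adj_neq zx).
  exists (x |: [set y; z]); first by rewrite setU11.
  apply/andP; split.
    by rewrite cardsU1 cards2 nyz !inE negb_or nxy [x == z]eq_sym nzx.
  apply/subsetP => e; rewrite inE; have [a [b eab]] := edge_ends e.
  have nab := edge_neq eab; rewrite eab subUset !sub1set !inE => /andP[aS bS].
  suff /adjP[e' e'G e'ab] : adj G a b.
    by have -> : e = e' by apply: val_inj; rewrite eab e'ab.
  move: aS bS nab; case/or3P=> /eqP->; case/or3P=> /eqP->; rewrite ?eqxx // => _;
    by rewrite // adj_sym.
have /andP[/eqP S3 _] := SG.
have : (1 < #|S :\ x|)%N by move: S3; rewrite (cardsD1 x) xS; lia.
case/card_gt1P=> y [z [+ + yz]]; rewrite !inE => /andP[yx yS] /andP[zx zS].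
exists y, z; split; [|by apply: triangle_adj SG _ _ _..].
by apply: triangle_adj SG _ _ _ => //; rewrite eq_sym.
Qed.

Lemma all_in_triangle_mono G H :
  G \subset H -> all_in_triangle G -> all_in_triangle H.
Proof.
move=> GH Gt x; have /in_triangleP[S xS SG] := Gt x.
by apply/in_triangleP; exists S => //; apply: triangle_mono SG.
Qed.

End Triangles.

(** * Two equivalence relations covering a graph in which large sets are joined *)

Section Classes.
Variable T : finType.
Implicit Types (e r b : rel T) (S U : {set T}) (G H : {set edge T}) (m : nat).

Definition joined G m : bool :=
  [forall S : {set T}, forall U : {set T},
     [disjoint S & U] && (m <= #|S|)%N && (m <= #|U|)%N ==>
     [exists x in S, exists y in U, adj G x y]].

Lemma joined_mono G H m : G \subset H -> joined G m -> joined H m.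
Proof.
move=> GH /forallP Gm; apply/forallP => S; apply/forallP => U.
apply/implyP => SU; have /forallP/(_ U) := Gm S; rewrite SU /=.
case/exists_inP=> x xS /exists_inP[y yU xy].
apply/exists_inP; exists x => //; apply/exists_inP; exists y => //.
exact: adj_mono GH xy.
Qed.

(** Take a smallest union of classes [S] with at least [s] elements. If its complement has fewer
    than [s], then removing one class from [S] also leaves fewer than [s], by minimality, so that
    class misses fewer than [2 * s] elements. *)
Lemma split_classes e (s : nat) :
  equivalence_rel e -> (0 < s <= #|T|)%N ->
  (exists x, (#|T| < #|[set y | e x y]| + 2 * s)%N) \/
  exists S : {set T}, [/\ forall x y, e x y -> (x \in S) = (y \in S),
                (s <= #|S|)%N & (s <= #|~: S|)%N].
Proof.
move=> eqv /andP[s0 sT].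
have e_refl x : e x x by have [] := eqv x x x.
have e_tr x y z : e x y -> e x z = e y z by have [_] := eqv x y z.
have e_sym x y : e x y -> e y x by move=> xy; rewrite -(e_tr _ _ _ xy) e_refl.
pose closed S := [forall x, forall y, e x y ==> ((x \in S) == (y \in S))].
have closedP S : reflect (forall x y, e x y -> (x \in S) = (y \in S)) (closed S).
  apply: (iffP idP) => [/forallP cS x y xy|cS].
    by have /forallP/(_ y) := cS x; rewrite xy => /eqP.
  by apply/forallP => x; apply/forallP => y; apply/implyP => /cS ->.
have PT : closed setT && (s <= #|[set: T]|)%N.
  by rewrite cardsT sT andbT; apply/closedP => x y _; rewrite !inE.
case: (@arg_minnP _ setT (fun S => closed S && (s <= #|S|)%N) (fun S => #|S|) PT).
move=> S /andP[/closedP cS sS] minS.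
have [sC|sC] := leqP s #|~: S|; first by right; exists S.
left; have /card_gt0P[x xS] : (0 < #|S|)%N by apply: leq_trans sS.
exists x; pose C := [set y | e x y]; rewrite -/C.
have CS : C \subset S.
  by apply/subsetP => y; rewrite inE => xy; rewrite -(cS x y xy).
have cD : closed (S :\: C).
  apply/closedP => y z yz; rewrite !inE (cS _ _ yz); congr (~~ _ && _).
  by apply/idP/idP => [xy|xz]; rewrite (e_tr _ _ _ xy) || rewrite (e_tr _ _ _ xz) // e_sym.
have Ds : (#|S :\: C| < s)%N.
  rewrite ltnNge; apply/negP => sD.
  have := minS (S :\: C); rewrite cD sD => /(_ isT).
  rewrite cardsD (setIidPr CS).
  have : (0 < #|C|)%N by apply/card_gt0P; exists x; rewrite inE.
  by have := subset_leq_card CS; lia.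
have := cardsC S; move: Ds; rewrite cardsD (setIidPr CS).
have := subset_leq_card CS; lia.
Qed.

(* If neither relation has a huge class, split the vertices into two halves
   along either one: some two opposite cells of the resulting 2 x 2 grid are
   both large, and no edge of [G] joins opposite cells. *)
Lemma joined_class G r b (m : nat) :
  equivalence_rel r -> equivalence_rel b ->
  (forall x y, adj G x y -> r x y || b x y) ->
  joined G m -> (0 < m)%N -> (2 * m <= #|T|)%N ->
  (exists x, (#|T| < #|[set y | r x y]| + 4 * m)%N) \/
  (exists x, (#|T| < #|[set y | b x y]| + 4 * m)%N).
Proof.
move=> rE bE rb Gm m0 mT.
have m2T : (0 < 2 * m <= #|T|)%N by rewrite muln_gt0 /= m0.
have [[x rx]|[I [cI I1 I2]]] := split_classes rE m2T.
  by left; exists x; rewrite mulnA in rx.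
have [[x bx]|[J [cJ J1 J2]]] := split_classes bE m2T.
  by right; exists x; rewrite mulnA in bx.
exfalso.
have opp (I' J' : {set T}) : (forall x y, r x y -> (x \in I') = (y \in I')) ->
    (forall x y, b x y -> (x \in J') = (y \in J')) ->
    (m <= #|I' :&: J'|)%N -> (m <= #|~: I' :&: ~: J'|)%N -> False.
  move=> cI' cJ' mIJ mIJ'.
  have /forallP/(_ (I' :&: J'))/forallP/(_ (~: I' :&: ~: J')) := Gm.
  have -> : [disjoint I' :&: J' & ~: I' :&: ~: J'].
    by apply/pred0P => z /=; rewrite !inE; case: (z \in I'); rewrite ?andbF.
  rewrite mIJ mIJ' /=.
  case/exists_inP=> x; rewrite inE => /andP[xI xJ].
  case/exists_inP=> y; rewrite !inE => /andP[yI yJ] /rb /orP[/cI'|/cJ'].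
    by rewrite xI (negbTE yI).
  by rewrite xJ (negbTE yJ).
have cJc x y : b x y -> (x \in ~: J) = (y \in ~: J) by rewrite !inE => /cJ ->.
have := opp _ _ cI cJ; have := opp _ _ cI cJc; rewrite setCK.
have := cardsID J I; have := cardsID J (~: I).
have := cardsID I J; have := cardsID I (~: J).
rewrite !setDE ![_ :&: I]setIC ![_ :&: ~: I]setIC.
move: I1 I2 J1 J2.
move: #|I :&: J| #|~: I :&: ~: J| #|I :&: ~: J| #|~: I :&: J| => a d b' c.
move: #|I| #|~: I| #|J| #|~: J| => i i' j j'.
move=> h1 h2 h3 h4 e1 e2 e3 e4 H1 H2.
(* If neither diagonal consisted of two cells of size at least [m], a small cell from each diagonal
   would together form a row or a column, which has at least [2 * m] elements. *)
case: (leqP m a) => ma; case: (leqP m d) => md;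
 case: (leqP m b') => mb; case: (leqP m c) => mc;
 solve [exact: H1 | exact: H2 | lia].
Qed.

End Classes.

(** * A vertex outside all triangles yields a NAC-colouring *)

Section NACnecessary.
Variables (T : finType) (G : {set edge T}).
Implicit Types (s : seq T) (x y z : T).

Lemma cycle_edgesP s (e : edge_of G) :
  reflect (exists2 x, x \in s & val (val e) = [set x; next s x])
          (e \in cycle_edges G s).
Proof.
rewrite inE; apply: (iffP existsP) => [[x /andP[xs /eqP ex]]|[x xs ex]]; exists x => //.
by rewrite xs ex eqxx.
Qed.

Lemma cycle_edge_exists s x : cycle (adj G) s -> x \in s ->
  exists2 e, e \in cycle_edges G s & val (val e) = [set x; next s x].
Proof.
move=> cs xs; have /adjP[e eG exy] := next_cycle cs xs.
by exists (Sub e eG : edge_of G); first by apply/cycle_edgesP; exists x.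
Qed.

Lemma card_neq1 (S : finType) (A : {set S}) a b :
  a \in A -> b \in A -> a != b -> #|A| <> 1%N.
Proof.
move=> aA bA ab A1; have /card_le1_eqP/(_ a b aA bA) ab' : (#|A| <= 1)%N by rewrite A1.
by rewrite ab' eqxx in ab.
Qed.

Lemma cycle_edge_colours s (c : edge_of G -> bool) k x y :
  cycle (adj G) s -> x \in s -> y \in s ->
  [set x; next s x] != [set y; next s y] ->
  (forall e, val (val e) = [set x; next s x] -> c e = k) ->
  (forall e, val (val e) = [set y; next s y] -> c e = k) ->
  #|[set e in cycle_edges G s | c e == k]| <> 1%N.
Proof.
move=> cs xs ys xy cx cy.
have [e es ex] := cycle_edge_exists cs xs.
have [e' es' ey] := cycle_edge_exists cs ys.
apply: (@card_neq1 _ _ e e'); [by rewrite in_set es cx ?eqxx|by rewrite in_set es' cy ?eqxx|].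
by apply: contra xy => /eqP ee'; rewrite -ex -ey ee'.
Qed.

(* Colouring the edges at [x] red and the others blue. *)
Lemma no_triangle_NAC x (e0 : edge_of G) :
  ~ in_triangle G x -> (exists y, adj G x y) -> x \notin val (val e0) ->
  has_NAC_colouring G.
Proof.
move=> tx [y xy] e0x; pose c (e : edge_of G) := x \in val (val e).
exists c; split=> [[]|s /and3P[ss us cs] k].
- have /adjP[e eG exy] := xy; exists (Sub e eG : edge_of G).
  by rewrite /c /= exy !inE eqxx.
- by exists e0; apply/negbTE.
have nextI : injective (next s) by apply: can_inj (prev_next us).
have [xs|xs] := boolP (x \in s); last first.
  (* A cycle avoiding [x] is entirely blue: its first two edges are blue, and no edge is red. *)
  case: k; last first.
    case: s ss us cs xs {nextI} => [|a [|b [|d s]]] // _ us cs xs.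
    have nab : next [:: a, b, d & s] a = b by rewrite /= eqxx.
    have nbd : next [:: a, b, d & s] b = d.
      move: us; rewrite /= !inE !negb_or => /andP[/and3P[ab _ _] _].
      by rewrite eq_sym (negbTE ab) eqxx.
    apply: (@cycle_edge_colours _ _ _ a b); rewrite ?nab ?nbd ?inE ?eqxx ?orbT //.
    - move: us; rewrite /= !inE !negb_or => /andP[/and3P[ab ad _] _].
      apply/negP => /eqP/setP/(_ a); rewrite !inE eqxx /=.
      by rewrite (negbTE ab) (negbTE ad).
    - move=> e ee; rewrite /c ee !inE; move: xs; rewrite !inE !negb_or.
      by case/and4P=> xa xb _ _; rewrite (negbTE xa) (negbTE xb).
    - move=> e ee; rewrite /c ee !inE; move: xs; rewrite !inE !negb_or.
      by case/and4P=> _ xb xd _; rewrite (negbTE xb) (negbTE xd).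
  apply/eqP; rewrite eqn_leq negb_and; apply/orP; right; rewrite -ltnNge.
  rewrite ltnS leqn0 cards_eq0; apply/eqP/setP => e; rewrite !inE.
  apply/negP => /andP[/existsP[z /andP[zs /eqP ez]]]; rewrite /c ez eqb_id !inE.
  case/orP=> /eqP xz; first by rewrite xz zs in xs.
  by rewrite xz mem_next zs in xs.
pose w := prev s x; have ws : w \in s by rewrite mem_prev.
have nw : next s w = x by rewrite next_prev.
pose v := next s x; have vs : v \in s by rewrite mem_next.
have xv : x != v by apply: adj_neq (next_cycle cs xs).
have wx : w != x by rewrite -[X in _ != X]nw; apply: adj_neq (next_cycle cs ws).
have wv : w != v.
  have [i s' rs] := rot_to ws.
  have ur : uniq (rot i s) by rewrite rot_uniq.
  have sr : (2 < size (rot i s))%N by rewrite size_rot.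
  have nwr : next (rot i s) w = x by rewrite next_rot.
  have nxr : next (rot i s) x = v by rewrite next_rot.
  move: ur sr nwr nxr; rewrite rs; case: s' {rs} => [|a [|d s']] //=.
  rewrite eqxx => /and3P[+ + _] _ <-; rewrite !inE !negb_or.
  by move=> /and3P[wa wd _] _; rewrite eq_sym (negbTE wa) eqxx => <-.
case: k.
  apply: (@cycle_edge_colours _ _ _ w x) => //; rewrite ?nw -/v.
  - by apply/negP => /eqP/setP/(_ w); rewrite !inE eqxx (negbTE wx) (negbTE wv).
  - by move=> e ee; rewrite /c ee !inE eqxx orbT.
  - by move=> e ee; rewrite /c ee !inE eqxx.
(* Two blue edges are those leaving [v] and [u], the vertices following [x]. The edge leaving [u]
   avoids [x], since otherwise [x], [v], [u] would form a triangle. *)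
pose u := next s v; have us' : u \in s by rewrite mem_next.
have vu : v != u by apply: adj_neq (next_cycle cs vs).
have xu : x != u.
  by rewrite -nw (inj_eq nextI).
have avx : adj G x v by apply: next_cycle cs xs.
have avu : adj G v u by apply: next_cycle cs vs.
have nu : next s u != x.
  apply/negP => /eqP nux; apply: tx; exists v, u; split=> //.
  by rewrite -nux; apply: next_cycle cs us'.
apply: (@cycle_edge_colours _ _ _ v u) => //; rewrite -/u.
- have nuv : next s u != v by rewrite (inj_eq nextI) eq_sym.
  apply/negP => /eqP/setP/(_ v); rewrite !inE eqxx (negbTE vu) /=.
  by rewrite eq_sym (negbTE nuv).
- move=> e ee; rewrite /c ee !inE (negbTE xv) (negbTE xu) //.
- by move=> e ee; rewrite /c ee !inE (negbTE xu) /= eq_sym (negbTE nu).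
Qed.

(** Any cycle would have an edge avoiding [x], so there are no cycles and every colouring using both
    colours qualifies. *)
Lemma star_NAC x (e0 e1 : edge_of G) :
  (forall e : edge_of G, x \in val (val e)) -> e0 != e1 -> has_NAC_colouring G.
Proof.
move=> star e01; exists (fun e => e == e0); split.
  by case; [exists e0; rewrite eqxx | exists e1; rewrite eq_sym (negbTE e01)].
move=> s /and3P[ss us cs]; exfalso.
suff [y ys /norP[xy xn]] : exists2 y, y \in s & ~~ ((x == y) || (x == next s y)).
  have [e _ ey] := cycle_edge_exists cs ys.
  by have := star e; rewrite ey !inE (negbTE xy) (negbTE xn).
have nextI : injective (next s) by apply: can_inj (prev_next us).
have [xs|xs] := boolP (x \in s); last first.
  case: s ss xs {us cs nextI} => [|a s] // _ xs; exists a; first by rewrite inE eqxx.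
  apply/norP; split; first by apply: contra xs => /eqP->; rewrite inE eqxx.
  by apply: contra xs => /eqP->; rewrite mem_next inE eqxx.
exists (next s x); first by rewrite mem_next.
have xv : x != next s x by apply: adj_neq (next_cycle cs xs).
rewrite negb_or xv /=.
have [i s' rs] := rot_to xs.
rewrite -!(next_rot i us) rs.
move: us ss; rewrite -(rot_uniq i) -(size_rot i) rs.
case: s' {rs} => [|a [|d s']] //=.
rewrite eqxx => /and3P[+ + _] _; rewrite !inE !negb_or => /and3P[xa xd _] _.
by rewrite [a == x]eq_sym (negbTE xa) eqxx.
Qed.

Lemma connected_no_NAC_triangle :
  (2 < #|T|)%N -> connected_no_NAC G -> all_in_triangle G.
Proof.
move=> T3 [Gc nN] x; apply: contrapT => tx; apply: nN.
have neigh y : y != x -> exists z, adj G y z.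
  have /connectP[[|z p]] := Gc y x; first by move=> _ /= ->; rewrite eqxx.
  by move=> /= /andP[yz _] _ _; exists z.
have /card_gt1P[y [z [+ + yz]]] : (1 < #|[set~ x]|)%N.
  by rewrite cardsC1; lia.
rewrite !inE => yx zx.
have [z' yz'] := neigh y yx.
have [z2 zz2] := neigh z zx.
(* If every edge contains [x], colouring by incidence with [x] leaves no blue edge; the edges at [y]
   and at [z] are then distinct, and [star_NAC] takes over. *)
have [star|/existsNP[e0 /negP xe0]] := pselect (forall e : edge_of G, x \in val (val e)).
  have /adjP[e eG eE] := yz'; have /adjP[f fG fE] := zz2.
  apply: (@star_NAC x (Sub e eG : edge_of G) (Sub f fG : edge_of G)) => //.
  have := star (Sub e eG : edge_of G); have := star (Sub f fG : edge_of G).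
  rewrite /= eE fE !inE ![x == _]eq_sym (negbTE yx) (negbTE zx) /= => /eqP z2x /eqP z'x.
  apply/negP => /eqP/(congr1 val) /= ef; move: eE; rewrite ef fE z2x z'x.
  by move=> /setP/(_ y); rewrite !inE eqxx (negbTE yz) (negbTE yx).
apply: (no_triangle_NAC tx _ xe0).
have /connectP[[|t p]] := Gc x y; first by move=> _ /= xy; rewrite xy eqxx in yx.
by move=> /= /andP[xt _] _; exists t.
Qed.

End NACnecessary.

(** * From a NAC-colouring to a small set that no triangle meets in exactly one vertex *)

Section NACsufficient.
Variables (T : finType) (G : {set edge T}).
Implicit Types (s : seq T) (x y z : T) (c : edge_of G -> bool) (U : {set T}).

Definition colour_adj c (k : bool) : rel T :=
  fun x y => [exists e : edge_of G, (c e == k) && (val (val e) == [set x; y])].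

Lemma colour_adjP c k x y :
  reflect (exists2 e, c e = k & val (val e) = [set x; y]) (colour_adj c k x y).
Proof.
apply: (iffP existsP) => [[e /andP[/eqP ek /eqP exy]]|[e ek exy]]; exists e => //.
by rewrite ek exy !eqxx.
Qed.

Lemma colour_adj_sym c k : symmetric (colour_adj c k).
Proof. by move=> x y; rewrite /colour_adj; under eq_existsb do rewrite setUC. Qed.

Lemma colour_adjW c k : subrel (colour_adj c k) (adj G).
Proof.
move=> x y /colour_adjP[e _ exy]; apply/adjP; exists (val e) => //.
exact: (valP e).
Qed.

Lemma adj_colour c x y : adj G x y -> colour_adj c true x y || colour_adj c false x y.
Proof.
case/adjP=> e eG exy; pose f : edge_of G := Sub e eG.
by apply/orP; case cf: (c f); [left|right]; apply/colour_adjP; exists f.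
Qed.

Lemma connect_equivalence (e : rel T) : symmetric e -> equivalence_rel (connect e).
Proof.
move=> es x y z; split=> [|xy]; first exact: connect0.
by apply: same_connect => //; apply: sym_connect_sym.
Qed.

Lemma next_last x (s : seq T) : uniq (x :: s) -> next (x :: s) (last x s) = x.
Proof.
move=> us; rewrite next_nth mem_last index_last //; exact: nth_default.
Qed.

(* A [k]-coloured path between the ends of an edge of the other colour closes
   up to a cycle on which that edge is the only one of its colour. *)
Lemma NAC_no_path c k e x y :
  NAC_colouring c -> c e = ~~ k -> val (val e) = [set x; y] ->
  ~~ connect (colour_adj c k) x y.
Proof.
move=> [_ cyc] ek exy; apply/negP => /connectP[p0 p0path p0last].
case/shortenP: p0path p0last => p ppath up _ ylast {p0}.
have uniq_edge (f : edge_of G) : val (val f) = [set x; y] -> f = e.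
  by move=> fxy; do 2![apply: val_inj]; rewrite exy fxy.
(* [r] allows a [k]-coloured step or the closing step from [y] to [x], so that each edge of the
   cycle is known to be [k]-coloured or equal to [e]. *)
pose r a b := colour_adj c k a b || ((a == y) && (b == x)).
have cr : cycle r (x :: p).
  rewrite /= rcons_path; apply/andP; split; last by rewrite /r -ylast !eqxx orbT.
  by apply: sub_path ppath => a b ab; rewrite /r ab.
have yx : adj G y x.
  by apply/adjP; exists (val e); [apply: (valP e)|rewrite exy setUC].
have ps : (2 < size (x :: p))%N.
  case: p ppath ylast {up cr} => [|a [|b p]] //=.
    by move=> _ yx'; rewrite yx' in yx; have := adj_neq yx; rewrite eqxx.
  rewrite andbT => /colour_adjP[f fk fxa] ya.
  by move: fk; rewrite (uniq_edge f) ?ya // ek; case: (k).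
have cs : is_cycle G (x :: p).
  apply/and3P; split=> //; rewrite /= rcons_path; apply/andP; split.
    by apply: sub_path ppath => a b; apply: colour_adjW.
  by rewrite -ylast.
apply: (cyc _ cs (~~ k)); apply/eqP/cards1P; exists e; apply/setP => f.
rewrite in_set1 !in_set; apply/andP/eqP => [[/existsP[z /andP[zs /eqP fz]] fk]|->].
  have /orP[/colour_adjP[g gk gz]|/andP[/eqP zy /eqP nx]] := next_cycle cr zs.
    have fg : f = g by do 2![apply: val_inj]; rewrite fz gz.
    by move: fk; rewrite fg gk; case: (k).
  by apply: uniq_edge; rewrite fz nx zy setUC.
rewrite ek eqxx; split=> //; apply/existsP; exists y.
have ys : y \in x :: p by rewrite ylast mem_last.
have ny : next (x :: p) y = x by rewrite ylast next_last.
by rewrite ys ny exy setUC eqxx.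
Qed.

Lemma card_setI1 (S U : {set T}) : #|S| = 3%N -> #|S :&: U| = 1%N ->
  exists u x y, [/\ u \in U, x \notin U, y \notin U, x != y &
     [/\ u \in S, x \in S & y \in S]].
Proof.
move=> S3 SU.
have /cards1P[u /setP uE] : #|S :&: U| == 1%N by rewrite SU.
have /card_gt1P[x [y [+ + xy]]] : (1 < #|S :\: U|)%N.
  by rewrite cardsD SU S3.
rewrite !inE => /andP[xU xS] /andP[yU yS]; exists u, x, y.
by have := uE u; rewrite !inE eqxx => /andP[-> ->].
Qed.

Lemma card_compl_class (r : rel T) x m :
  (#|T| < #|[set y | r x y]| + 4 * m)%N -> (#|[set y | ~~ r x y]| <= 4 * m)%N.
Proof.
move=> xm; have -> : [set y | ~~ r x y] = ~: [set y | r x y].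
  by apply/setP => y; rewrite !inE.
by rewrite cardsCs setCK; lia.
Qed.

(** Suppose a triangle has one vertex [u] in [U] and [y], [z] outside. Its edges at [u] have colour
    [~~ k], as [u] is not in the [k]-component of [x]. Whatever the colour of the third edge, its
    ends are joined by a path of the other colour, through [u] or inside the component, against
    [NAC_no_path]. *)
Lemma NAC_class c k x :
  NAC_colouring c ->
  let U := [set y | ~~ connect (colour_adj c k) x y] in
  (0 < #|U|)%N /\ forall S, triangle G S -> #|S :&: U| <> 1%N.
Proof.
move=> cN U; set r := connect (colour_adj c k).
have rE : equivalence_rel r by apply/connect_equivalence/colour_adj_sym.
have r_class y z : r x y -> r x z -> r y z.
  by move=> xy xz; have [_ /(_ xy) <-] := rE x y z.
have r_sym k' : connect_sym (colour_adj c k').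
  exact/sym_connect_sym/colour_adj_sym.
split.
  have [onto _] := cN; have [e ek] := onto (~~ k).
  have [y [z eyz]] := edge_ends (val e).
  have yz := NAC_no_path cN ek eyz.
  apply/card_gt0P; have [xy|xy] := boolP (r x y); last by exists y; rewrite inE.
  by exists z; rewrite inE; apply: contra yz; apply: r_class.
move=> S SG SU; have /andP[/eqP S3 _] := SG.
have [u [y [z [uU yU zU yz [uS yS zS]]]]] := card_setI1 S3 SU.
move: (uU) (yU) (zU); rewrite !inE !negbK -/r => xu xy xz.
have uy : u != y by apply: contraNneq yU => <-.
have uz : u != z by apply: contraNneq zU => <-.
have out v : r x v -> v \in S -> u != v -> colour_adj c (~~ k) u v.
  move=> xv vS uv; have := adj_colour c (triangle_adj SG uS vS uv).
  have -> : colour_adj c true u v || colour_adj c false u v =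
    colour_adj c k u v || colour_adj c (~~ k) u v by case: (k); rewrite // orbC.
  case/orP=> // uvk; case/negP: xu; apply: connect_trans xv _.
  by rewrite r_sym; apply: connect1.
have [uy' uz'] := (out y xy yS uy, out z xz zS uz).
have /adjP[e eG eyz] := triangle_adj SG yS zS yz.
pose f : edge_of G := Sub e eG.
have [fk|fk] : c f = k \/ c f = ~~ k by case: (c f) (k) => [] []; auto.
  have : ~~ connect (colour_adj c (~~ k)) y z.
    exact: (NAC_no_path cN (etrans fk (esym (negbK k))) (eyz : val (val f) = _)).
  case/negP; apply: connect_trans (connect1 uz').
  by rewrite r_sym; apply: connect1.
have /negP := NAC_no_path cN fk (eyz : val (val f) = _); apply; exact: r_class xy xz.
Qed.

(** [joined] is asked of a subgraph [A] because it is controlled at a fixed time, whereas [G] is the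
    graph at a random one. *)
Lemma not_connected_no_NAC m (A : {set edge T}) :
  A \subset G -> joined A m -> (0 < m)%N -> (2 * m <= #|T|)%N ->
  ~ connected_no_NAC G ->
  exists2 U : {set T}, (0 < #|U| <= 4 * m)%N &
    forall S, triangle G S -> #|S :&: U| <> 1%N.
Proof.
move=> AG Am m0 mT nG.
have adj_csym : symmetric (adj G) by move=> x y; apply: adj_sym.
have [Gc|nGc] := pselect (connected G).
  have /contrapT[c cN] : ~ ~ has_NAC_colouring G by move=> nN; apply: nG.
  have cE k : equivalence_rel (connect (colour_adj c k)).
    exact/connect_equivalence/colour_adj_sym.
  have [|[x xm]|[x xm]] := joined_class (cE true) (cE false) _ Am m0 mT.
  - move=> x y /(adj_mono AG)/(adj_colour c) /orP[] xy; apply/orP; [left|right];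
    exact: connect1.
  - have [U0 US] := NAC_class true x cN.
    by exists [set y | ~~ connect (colour_adj c true) x y]; rewrite ?U0 ?card_compl_class.
  - have [U0 US] := NAC_class false x cN.
    by exists [set y | ~~ connect (colour_adj c false) x y]; rewrite ?U0 ?card_compl_class.
(* For a disconnected graph, connectivity serves as both relations in [joined_class]. *)
have eqv : equivalence_rel (connect (adj G)) by apply: connect_equivalence.
have [x xm] : exists x, (#|T| < #|[set y | connect (adj G) x y]| + 4 * m)%N.
  have [|//|//] := joined_class eqv eqv _ Am m0 mT.
  by move=> x y /(adj_mono AG) xy; rewrite orbb connect1.
exists [set y | ~~ connect (adj G) x y].
  rewrite card_compl_class // andbT; apply/card_gt0P.
  apply: contrapT => nU; apply: nGc => y z.
  have all_x v : connect (adj G) x v.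
    by apply: contrapT => /negP xv; apply: nU; exists v; rewrite inE.
  apply: connect_trans (all_x z); rewrite (sym_connect_sym adj_csym); exact: all_x.
move=> S SG SU; have /andP[/eqP S3 _] := SG.
have [u [y [z [+ + _ _ [uS yS _]]]]] := card_setI1 S3 SU.
rewrite !inE negbK => xu xy; case/negP: (xu).
have yu : y != u by apply: contraNneq xu => <-.
by apply: connect_trans xy _; apply/connect1/(triangle_adj SG).
Qed.

End NACsufficient.

(** * The random graph process and exchangeable pairs of random graphs *)

From mathcomp Require Import fingroup perm.

Lemma leq_bool (a b : bool) : (a -> b) -> (a <= b)%N.
Proof. by case: a => // ->. Qed.

Section UniformOrder.
Variables (R : realType) (n : nat).
Notation E := (edge 'I_n).
Implicit Types (w : outcome n) (A B C : {set E}) (s : {perm E}).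

Lemma card_edge : #|{: E}| = 'C(n, 2).
Proof. by rewrite card_sig -[n in RHS]card_ord -card_draws cardsE. Qed.

Definition first_outcome : outcome n :=
  [ffun i => enum_val (cast_ord (esym card_edge) i)].

Definition perm_outcome s : outcome n := [ffun i => s (first_outcome i)].

Lemma process_mono w (t u : nat) : (t <= u)%N -> process w t \subset process w u.
Proof.
move=> tu; apply: imsetS; apply/subsetP => i; rewrite !inE => it.
exact: leq_trans it tu.
Qed.

Lemma card_process w (t : nat) : injective w -> (t <= 'C(n, 2))%N -> #|process w t| = t.
Proof.
move=> winj tN; rewrite card_imset // -sum1dep_card (big_ord_narrow tN).
by rewrite sum1_card card_ord.
Qed.

Lemma first_outcome_inj : injective first_outcome.
Proof.
by move=> i j; rewrite !ffunE => /enum_val_inj/cast_ord_inj.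
Qed.

Lemma process_perm s t : process (perm_outcome s) t = s @: process first_outcome t.
Proof. by rewrite /process -imset_comp; apply: eq_imset => i; rewrite /= !ffunE. Qed.

Lemma mem_process_first (t : nat) e :
  (e \in process first_outcome t) = (enum_rank e < t)%N.
Proof.
apply/imsetP/idP => [[i it ->]|et].
  by rewrite ffunE enum_valK /=; rewrite inE in it.
exists (cast_ord card_edge (enum_rank e)); first by rewrite inE.
by rewrite ffunE cast_ordK enum_rankK.
Qed.

Lemma perm_outcome_inj : injective perm_outcome.
Proof.
move=> s s' /ffunP ss; apply/permP => e.
by have := ss (cast_ord card_edge (enum_rank e)); rewrite !ffunE cast_ordK enum_rankK.
Qed.

Lemma injective_outcomes :
  [set w : outcome n | injectiveb w] = [set perm_outcome s | s in [set: {perm E}]].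
Proof.
apply/esym/eqP; rewrite eqEcard; apply/andP; split.
  apply/subsetP => _ /imsetP[s _ ->]; rewrite inE; apply/injectiveP => i j.
  by rewrite !ffunE => /perm_inj/enum_val_inj/cast_ord_inj.
rewrite card_inj_ffuns (card_imset _ perm_outcome_inj) card_ord card_edge ffactnn.
have -> : #|[set: {perm E}]| = #|perm_on [set: E]|.
  apply: eq_card => s; rewrite !inE; apply/esym/subsetP => x _; exact: in_setT.
by rewrite card_perm cardsT card_edge.
Qed.

Lemma outcome_mass_inj w : injective w ->
  outcome_mass R w = #|[set: {perm E}]|%:R^-1.
Proof.
move=> winj.
have -> : #|[set: {perm E}]| = ('C(n, 2))`!.
  rewrite -(card_imset _ perm_outcome_inj) -injective_outcomes card_inj_ffuns.
  by rewrite card_ord card_edge ffactnn.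
rewrite -ffactnn ffact_prod natr_prod -prodfV; apply: eq_bigr => i _.
rewrite /uniform_mass cardsCs setCK card_edge card_process //; last exact: ltnW.
rewrite inE; case: imsetP => [[j ji /winj ij]|_]; last by rewrite mul1r.
by rewrite inE ij ltnn in ji.
Qed.

Lemma outcome_mass_noninj w : ~~ injectiveb w -> outcome_mass R w = 0.
Proof.
move=> /injectivePn[i [j ij wij]].
wlog lt_ij : i j ij wij / (i < j)%N.
  move=> H; case: (ltngtP i j) => [|ji|/val_inj ij']; first exact: H.
    by apply: (H j i) => //; rewrite eq_sym.
  by rewrite ij' eqxx in ij.
rewrite /outcome_mass (bigD1 j) //= /uniform_mass inE.
have -> : w j \in process w j by rewrite -wij; apply: imset_f; rewrite inE.
by rewrite !mul0r.
Qed.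

(** The chain rule gives each ordering of the edges the same mass and gives mass 0 to outcomes with
    a repeated edge: the process is a uniformly random permutation of [first_outcome]. *)
Lemma Pr_perm (Q : pred (outcome n)) :
  Pr R Q = #|[set: {perm E}]|%:R^-1 * \sum_s (Q (perm_outcome s))%:R.
Proof.
rewrite /Pr (bigID (fun w : outcome n => injectiveb w)) /= [X in _ + X]big1 ?addr0; last first.
  by move=> w /andP[_ /outcome_mass_noninj].
transitivity (\sum_(w in [set w : outcome n | injectiveb w])
    (#|[set: {perm E}]|%:R^-1 * (Q w)%:R : R)).
  rewrite big_mkcond [RHS]big_mkcond /=; apply: eq_bigr => w _; rewrite inE.
  case: (boolP (injectiveb w)) => [/injectiveP/outcome_mass_inj wm|]; rewrite ?andbF //.
  by rewrite andbT; case: (Q w); rewrite ?mulr1 ?mulr0.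
rewrite injective_outcomes big_imset /=; last by move=> s s' _ _; apply: perm_outcome_inj.
by rewrite mulr_sumr; apply: eq_bigl => s; rewrite inE.
Qed.

Lemma Pr_ge0 (Q : pred (outcome n)) : 0 <= Pr R Q.
Proof.
by rewrite Pr_perm mulr_ge0 ?invr_ge0 ?sumr_ge0.
Qed.

Lemma le_Pr (Q Q' : pred (outcome n)) :
  (forall w, injective w -> Q w -> Q' w) -> Pr R Q <= Pr R Q'.
Proof.
move=> QQ; rewrite !Pr_perm ler_wpM2l ?invr_ge0 //; apply: ler_sum => s _.
rewrite ler_nat leq_bool //; apply: QQ => i j.
by rewrite !ffunE => /perm_inj/enum_val_inj/cast_ord_inj.
Qed.

Lemma PrU (Q Q' : pred (outcome n)) :
  Pr R (fun w => Q w || Q' w) <= Pr R Q + Pr R Q'.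
Proof.
rewrite !Pr_perm -mulrDr -big_split /= ler_wpM2l ?invr_ge0 //.
apply: ler_sum => s _; rewrite -natrD ler_nat.
by case: (Q _); case: (Q' _).
Qed.

Lemma PrC (Q : pred (outcome n)) : Pr R (fun w => ~~ Q w) = 1 - Pr R Q.
Proof.
have K0 : #|[set: {perm E}]|%:R != 0 :> R.
  by rewrite pnatr_eq0 -lt0n; apply/card_gt0P; exists 1%g; rewrite inE.
apply/eqP; rewrite eq_sym subr_eq -{1}(mulVf K0) !Pr_perm -mulrDr -big_split /=.
rewrite -sum1_card natr_sum; apply/eqP; congr (_ * _).
rewrite big_mkcond; apply: eq_bigr => s _; rewrite inE.
by case: (Q _); rewrite /= ?addr0 ?add0r.
Qed.

(** List [B], then [C :\: B], then the rest. Nested pairs of given sizes thus form a single orbit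
    under permutations. *)
Lemma chain_perm B C : B \subset C ->
  exists s, s @: process first_outcome #|B| = B /\ s @: process first_outcome #|C| = C.
Proof.
move=> BC; pose r := enum B ++ enum (C :\: B) ++ enum (~: C).
have mem_r e : e \in r.
  rewrite !mem_cat !mem_enum !inE; case: (boolP (e \in C)); rewrite ?orbT // andbT.
  by rewrite orbF orbN.
have r_size : size r = #|E|.
  rewrite !size_cat -!cardE cardsD (setIidPr BC) addnA subnKC ?subset_leq_card //.
  exact: cardsC.
have r_uniq : uniq r.
  apply: (@leq_size_uniq _ (enum {: E})); first exact: enum_uniq.
    by move=> e _; apply: mem_r.
  by rewrite -cardE r_size.
have rank_lt (e : E) : (enum_rank e < size r)%N by rewrite r_size ltn_ord.
have f_inj : injective (fun e : E => nth e r (enum_rank e)).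
  move=> e e'; rewrite (set_nth_default e') // => /eqP.
  by rewrite nth_uniq // => /eqP/val_inj/enum_rank_inj.
have sub (r1 r2 : seq E) (D : {set E}) : r = r1 ++ r2 -> r1 =i D -> uniq r1 ->
    perm f_inj @: process first_outcome #|D| = D.
  move=> rE rD u1; have sz : size r1 = #|D|.
    by rewrite (eq_card (fun x => esym (rD x))) -(card_uniqP u1).
  apply/eqP; rewrite eqEcard card_imset; last exact: perm_inj.
  apply/andP; split.
    apply/subsetP => _ /imsetP[e + ->]; rewrite mem_process_first permE => eD.
    by rewrite rE nth_cat sz eD -rD mem_nth // sz.
  rewrite card_process //; first exact: first_outcome_inj.
  by rewrite -card_edge max_card.
exists (perm f_inj); split; first by apply: sub (erefl r) _ (enum_uniq _) => e; rewrite mem_enum.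
apply: (sub (enum B ++ enum (C :\: B)) (enum (~: C))); first by rewrite -catA.
  move=> e; rewrite mem_cat !mem_enum !inE; case: (boolP (e \in B)) => //= eB.
  by rewrite (subsetP BC e eB).
by move: r_uniq; rewrite /r catA cat_uniq => /andP[].
Qed.

(* An exchangeable pair of random graphs (A, C), conditioned on the sizes a, c,
   is distributed as (G_a, G_c). *)
Lemma Pr_le_exchangeable (O : finType) (P : O -> R) (A C : O -> {set E})
    (Q : {set E} -> {set E} -> bool) (t u : nat) (shift : {perm E} -> O -> O) :
  (forall o, 0 <= P o) -> (forall o, A o \subset C o) ->
  (forall s, injective (shift s)) -> (forall s o, P (shift s o) = P o) ->
  (forall s o, A (shift s o) = s @: A o) -> (forall s o, C (shift s o) = s @: C o) ->
  (forall B B' D D' : {set E}, B' \subset B -> D \subset D' -> Q B D -> Q B' D') ->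
  Pr R (fun w => Q (process w t) (process w u)) *
    \sum_(o | (#|A o| <= t)%N && (u <= #|C o|)%N) P o <=
  \sum_(o | Q (A o) (C o)) P o.
Proof.
move=> P0 AC shift_inj Psh Ash Csh Qmono.
set K := #|[set: {perm E}]|%:R : R.
have K0 : 0 < K.
  by rewrite ltr0n; apply/card_gt0P; exists 1%g; rewrite inE.
rewrite Pr_perm -/K -mulrA ler_pdivrMl //.
(* Invariance of [P] under each [shift s] turns the event into an average over permutations, outcome
   by outcome. *)
have -> : K * \sum_(o | Q (A o) (C o)) P o =
    \sum_o P o * \sum_(s : {perm E}) (Q (s @: A o) (s @: C o))%:R.
  under [RHS]eq_bigr do rewrite mulr_sumr.
  rewrite exchange_big /= /K -sum1_card natr_sum mulr_suml.
  apply: eq_big => [s|s _]; first by rewrite inE.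
  rewrite mul1r (reindex_inj (shift_inj s)) /= big_mkcond; apply: eq_bigr => o _.
  by rewrite Psh Ash Csh; case: (Q _ _); rewrite ?mulr1 ?mulr0.
rewrite mulr_sumr [leLHS]big_mkcond /=; apply: ler_sum => o _.
case: ifP => [/andP[At uC]|_]; last by rewrite mulr_ge0 ?P0 ?sumr_ge0.
rewrite mulrC ler_wpM2l ?P0 //.
(* [A o] and [C o] are images under [s0] of initial segments, so composing with the inverse of [s0]
   makes this an average over orderings of the edges. *)
have [s0 [As0 Cs0]] := chain_perm (AC o).
rewrite [leRHS](reindex_inj (mulgI (s0^-1)%g)) /=.
apply: ler_sum => s _; rewrite !process_perm ler_nat leq_bool // => Qs.
have shiftE (D : {set E}) : (s0^-1 * s)%g @: (s0 @: D) = s @: D.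
  rewrite -imset_comp; apply: eq_imset => e /=.
  by rewrite permM permK.
rewrite -As0 -Cs0 !shiftE.
(* The size conditions on [o] let monotonicity replace the times [t] and [u] by the sizes of [A o]
   and [C o]. *)
by apply: Qmono Qs; apply/imsetS/process_mono.
Qed.

End UniformOrder.

(** * Cliques in binomial random graphs *)

Section CliqueCounting.
Variable T : finType.
Implicit Types (S U : {set T}) (x y : T).

Lemma card_clique S : #|clique S| = 'C(#|S|, 2).
Proof.
rewrite -cards_draws -(card_imset _ val_inj); apply: eq_card => X.
apply/imsetP/idP => [[e eS ->]|]; first by rewrite !inE in eS *; rewrite eS (valP e).
by rewrite inE => /andP[XS X2]; exists (Sub X X2 : edge T); rewrite ?inE.
Qed.

Lemma cliqueI S U : clique S :&: clique U = clique (S :&: U).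
Proof. by apply/setP => e; rewrite !inE subsetI. Qed.

(** For a single vertex these are all triples through it, so uncovered vertices and exceptional sets
    [U] share the same bounds. *)
Definition crossing U : {set {set T}} :=
  [set S : {set T} | (#|S| == 3%N) && (#|S :&: U| == 1%N)].

Lemma card_crossing_ge U : (#|U| * 'C(#|~: U|, 2) <= #|crossing U|)%N.
Proof.
rewrite -cards_draws -cardsX.
pose f (uP : T * {set T}) := uP.1 |: uP.2.
rewrite -(@card_in_imset _ _ f).
  apply: subset_leq_card; apply/subsetP => _ /imsetP[[u P] /setXP[/= uU + ->]].
  rewrite !inE => /andP[PU /eqP P2]; rewrite /f /=.
  have uP : u \notin P by apply/negP => /(subsetP PU); rewrite inE uU.
  have PU0 : P :&: U = set0.
    apply/setP => x; rewrite !inE; apply/negP => /andP[/(subsetP PU)].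
    by rewrite inE => /negbTE ->.
  by rewrite cardsU1 uP P2 setIUl PU0 setU0 (setIidPl _) ?cards1 ?sub1set.
move=> [u P] [v P'] /setXP[/= uU +] /setXP[/= vU +]; rewrite !inE /f /=.
move=> /andP[PU _] /andP[PU' _] /setP eq_uv.
have uv : u = v.
  have := eq_uv u; rewrite !inE eqxx /= => /esym/orP[/eqP//|/(subsetP PU')].
  by rewrite inE uU.
congr pair => //; apply/setP => x; have := eq_uv x; rewrite !inE -uv.
case: eqVneq => //= -> _; apply/idP/idP => [/(subsetP PU)|/(subsetP PU')];
by rewrite inE uU.
Qed.

Lemma mem_crossing1 u S : (S \in crossing [set u]) = (#|S| == 3%N) && (u \in S).
Proof.
rewrite inE; congr (_ && _); case: (boolP (u \in S)) => uS.
  by rewrite (setIidPr _) ?sub1set // cards1.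
suff -> : S :&: [set u] = set0 by rewrite cards0.
by apply/setP => x; rewrite !inE; case: eqP => [->|]; rewrite ?andbF // (negbTE uS).
Qed.

Lemma card_crossing1 u : #|crossing [set u]| = 'C(#|T|.-1, 2).
Proof.
apply/eqP; rewrite eqn_leq; apply/andP; split; last first.
  by have := card_crossing_ge [set u]; rewrite cards1 mul1n cardsC1.
rewrite -(cardsC1 u) -cards_draws.
rewrite -(@card_in_imset _ _ (fun S : {set T} => S :\ u) (crossing [set u])).
  apply: subset_leq_card; apply/subsetP => _ /imsetP[S + ->].
  rewrite mem_crossing1 => /andP[S3 uS]; rewrite inE; apply/andP; split.
    by apply/subsetP => x; rewrite !inE => /andP[].
  by move: S3; rewrite (cardsD1 u) uS.
move=> S S'; rewrite !mem_crossing1 => /andP[_ uS] /andP[_ uS'] SS'.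
by rewrite -(setD1K uS) SS' setD1K.
Qed.

(** Only triples made of [u], [v] and a third vertex are counted twice. This small overlap makes two
    vertices nearly independent in the second moment. *)
Lemma card_crossingU u v : u != v ->
  (2 * 'C(#|T|.-1, 2) <= #|crossing [set u] :|: crossing [set v]| + #|T|)%N.
Proof.
move=> uv; have := cardsUI (crossing [set u]) (crossing [set v]).
rewrite !card_crossing1.
suff : (#|crossing [set u] :&: crossing [set v]| <= #|T|)%N by lia.
apply: leq_trans (_ : #|[set [set u; v; w] | w in [set: T]]| <= _)%N; last first.
  by apply: leq_trans (leq_imset_card _ _) _; rewrite cardsT.
apply: subset_leq_card; apply/subsetP => S; rewrite inE !mem_crossing1.
move=> /andP[/andP[/eqP S3 uS] /andP[_ vS]].
have /cards1P[w Sw] : #|S :\ u :\ v| == 1%N.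
  have := cardsD1 u S; have := cardsD1 v (S :\ u).
  by rewrite !inE uS vS eq_sym uv S3; lia.
apply/imsetP; exists w => //; rewrite -setUA -Sw !setD1K //.
by rewrite !inE vS eq_sym uv.
Qed.

(** Such a triple arises from [S] by exchanging one of its three vertices. *)
Lemma card_near_triangles S : #|S| = 3%N ->
  (#|[set S' : {set T} | (#|S'| == 3%N) && (#|S' :&: S| == 2%N)]| <= 3 * #|T|)%N.
Proof.
move=> S3; rewrite -[X in (_ <= X * _)%N]S3 -cardsT -cardsX.
pose f (xv : T * T) := xv.2 |: (S :\ xv.1).
apply: leq_trans (leq_imset_card f _); apply: subset_leq_card.
apply/subsetP => S'; rewrite inE => /andP[/eqP S'3 /eqP SS'].
have /cards1P[x Sx] : #|S :\: S'| == 1%N by rewrite cardsD setIC SS' S3.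
have /cards1P[v Sv] : #|S' :\: S| == 1%N by rewrite cardsD SS' S'3.
apply/imsetP; exists (x, v).
  rewrite !inE andbT; have /setP/(_ x) := Sx; rewrite !inE eqxx.
  by case/andP.
apply/setP => y; rewrite !inE /=.
have /setP/(_ y) := Sx; have /setP/(_ y) := Sv; rewrite !inE => <- <-.
by case: (y \in S); case: (y \in S').
Qed.

Lemma card_cut S U : [disjoint S & U] ->
  (#|S| * #|U| <= #|[set P : {set T} |
     (#|P| == 2%N) && (#|P :&: S| == 1%N) && (#|P :&: U| == 1%N)]|)%N.
Proof.
move=> dis; rewrite -cardsX.
pose f (xy : T * T) := [set xy.1; xy.2].
have SU x : x \in S -> (x \in U) = false.
  by move=> xS; have /pred0P/(_ x) /= := dis; rewrite xS.
rewrite -(@card_in_imset _ _ f).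
  apply: subset_leq_card; apply/subsetP => _ /imsetP[[x y] /setXP[/= xS yU] ->].
  have yS : (y \in S) = false by apply/negP => /SU; rewrite yU.
  rewrite inE /f /=.
  have -> : [set x; y] :&: S = [set x].
    apply/setP => z; rewrite !inE; case: (eqVneq z x) => [->|_]; first by rewrite xS.
    by case: (eqVneq z y) => [->|_]; rewrite ?yS.
  have -> : [set x; y] :&: U = [set y].
    apply/setP => z; rewrite !inE; case: (eqVneq z y) => [->|_]; rewrite ?orbT ?yU //=.
    by rewrite orbF; case: eqP => [->|]//; rewrite SU.
  have xy : x != y by apply: contraTneq xS => ->; rewrite yS.
  by rewrite !cards1 cards2 xy.
move=> [x y] [x' y'] /setXP[/= xS yU] /setXP[/= xS' yU']; rewrite /f /= => /setP eqf.
have := eqf x; have := eqf y; rewrite !inE !eqxx orbT /=.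
move=> /esym/orP[/eqP yx|/eqP ->] /esym/orP[/eqP->|/eqP xy] //.
- by have := SU x' xS'; rewrite -yx yU.
- by have := SU x' xS'; rewrite -yx yU.
- by have := SU x xS; rewrite xy yU'.
Qed.

End CliqueCounting.

(** * Binomial random graphs embedded by [h] (identity, [inl] or [inr]) in a product space *)

Section RandomGraph.
Variables (R : realFieldType) (T J : finType) (h : edge T -> J) (p : J -> R) (q : R).
Hypotheses (p_ge0 : forall j, 0 <= p j) (p_le1 : forall j, p j <= 1).
Hypotheses (h_inj : injective h) (p_h : forall e, p (h e) = q).
Implicit Types (S U : {set T}) (L : {set {set T}}) (w : {set J}).
Notation n := #|T|.
Notation Prob := (prob p).

(** Members of size 3 stand for triangles and members of size 2 for single edges, so one Janson
    bound covers both. *)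
Definition no_clique L (A : {set edge T}) : bool :=
  [forall S in L, ~~ (clique S \subset A)].

Lemma no_cliqueE L w :
  no_clique L (h @^-1: w) = avoids (fun S => h @: clique S) L w.
Proof.
apply: eq_forallb => S; case: (S \in L) => //=; congr (~~ _).
by rewrite sub_imset_pre.
Qed.

Lemma weight_h (X : {set edge T}) : weight p (h @: X) = q ^+ #|X|.
Proof.
rewrite /weight big_imset /=; last by move=> e e' _ _; apply: h_inj.
by under eq_bigr do rewrite p_h; rewrite prodr_const.
Qed.

Lemma weight_clique S : weight p (h @: clique S) = q ^+ 'C(#|S|, 2).
Proof. by rewrite weight_h card_clique. Qed.

Lemma imsetD_h (X Y : {set edge T}) : h @: X :\: h @: Y = h @: (X :\: Y).
Proof.
apply/setP => j; rewrite inE; apply/andP/imsetP => [[jY /imsetP[e eX je]]|[e eXY ->]].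
  by exists e; rewrite // inE eX andbT; apply: contra jY => eY; rewrite je imset_f.
by move: eXY; rewrite inE => /andP[eY eX]; rewrite !mem_imset.
Qed.

Lemma disjoint_h S S' : ~~ [disjoint h @: clique S & h @: clique S'] ->
  (1 < #|S :&: S'|)%N.
Proof.
apply: contraR; rewrite -leqNgt => SS'; apply/pred0P => j /=.
apply/negP => /andP[/imsetP[e eS ->] /imsetP[e' eS' /h_inj ee']].
have : e \in clique (S :&: S') by rewrite -cliqueI inE eS ee' eS'.
have /eqP := card_clique (S :&: S'); rewrite bin_small ?ltnS // cards_eq0.
by move=> /eqP ->; rewrite inE.
Qed.

(** Janson with [d] equal to [3 * n%:R * q ^+ 2]: a triangle shares an edge with at most [3 * n]
    others, each of which needs two further edges. *)
Lemma prob_no_triangle_le L :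
  (forall S, S \in L -> #|S| = 3%N) -> 3 * n%:R * q ^+ 2 <= 1 -> 0 <= q ->
  Prob (fun w => no_clique L (h @^-1: w)) <=
    (1 - (1 - 3 * n%:R * q ^+ 2) * q ^+ 3) ^+ #|L|.
Proof.
move=> L3 d1 q0; under eq_prob do rewrite no_cliqueE.
apply: le_trans (prob_avoids_le p_ge0 p_le1 d1 _) _.
  move=> S SL; apply: (@le_trans _ _
    (\sum_(S' in [set S' : {set T} | (#|S'| == 3%N) && (#|S' :&: S| == 2%N)]) q ^+ 2)).
    rewrite big_mkcond [leRHS]big_mkcond /=; apply: ler_sum => S' _.
    case: ifP => [/andP[S'L /andP[S'S /disjoint_h SS']]|_]; last first.
      by case: ifP; rewrite ?exprn_ge0.
    have S3 := L3 _ SL; have S'3 := L3 _ S'L.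
    have SS'2 : #|S' :&: S| = 2%N.
      apply/eqP; rewrite eqn_leq SS' andbT -ltnS -S'3.
      apply: proper_card; rewrite properEneq subsetIl andbT.
      apply: contra S'S => /eqP/setIidPl S'S.
      by rewrite eqEcard S'S S3 S'3.
    rewrite inE S'3 SS'2 eqxx /= imsetD_h weight_h cardsD cliqueI !card_clique.
    by rewrite S'3 SS'2.
  rewrite sumr_const -[leLHS]mulr_natl ler_wpM2r ?exprn_ge0 //.
  by rewrite -natrM ler_nat card_near_triangles // L3.
rewrite -prodr_const; under eq_bigr do rewrite weight_clique.
rewrite le_eqVlt; apply/orP; left; apply/eqP; apply: eq_bigr => S SL.
by rewrite L3.
Qed.

Lemma prob_no_triangle_ge L :
  (forall S, S \in L -> #|S| = 3%N) ->
  (1 - q ^+ 3) ^+ #|L| <= Prob (fun w => no_clique L (h @^-1: w)).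
Proof.
move=> L3; under eq_prob do rewrite no_cliqueE.
apply: le_trans (prob_avoids_ge p_ge0 p_le1 _ _).
rewrite -prodr_const; under [leRHS]eq_bigr do rewrite weight_clique.
rewrite le_eqVlt; apply/orP; left; apply/eqP; apply: eq_bigr => S SL.
by rewrite L3.
Qed.

Lemma prob_no_edge_le L :
  (forall S, S \in L -> #|S| = 2%N) -> 0 <= q ->
  Prob (fun w => no_clique L (h @^-1: w)) <= (1 - q) ^+ #|L|.
Proof.
move=> L2 q0; under eq_prob do rewrite no_cliqueE.
(* [ler01] sets [d] to 0: distinct pairs of vertices have disjoint edge sets. *)
apply: le_trans (prob_avoids_le p_ge0 p_le1 (ler01) _) _.
  move=> S SL; rewrite big1 // => S' /andP[S'L /andP[S'S /disjoint_h SS']].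
  case/negP: S'S; rewrite eqEcard (L2 _ SL) (L2 _ S'L) leqnn andbT.
  apply/setIidPl/eqP; rewrite eqEcard subsetIl (L2 _ S'L); exact: SS'.
rewrite subr0 -prodr_const; under eq_bigr do rewrite mul1r weight_clique.
rewrite le_eqVlt; apply/orP; left; apply/eqP; apply: eq_bigr => S SL.
by rewrite L2.
Qed.

(** Chebyshev for the number of edges, whose variance is at most its mean. *)
Lemma prob_edges_deviation (d : R) (Q : pred {set J}) :
  0 <= d ->
  (forall w, Q w -> d <= `|#|h @^-1: w|%:R - #|edge T|%:R * q|) ->
  Prob Q * d ^+ 2 <= #|edge T|%:R * q.
Proof.
move=> d0 Qd; set N := #|edge T|.
have sizeE w : #|h @^-1: w| = (\sum_e (h e \in w))%N.
  by rewrite -sum1dep_card big_mkcond; apply: eq_bigr => e _; case: (h e \in w).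
have prob1 e : Prob (fun w => h e \in w) = q.
  rewrite (@eq_prob _ _ _ _ (fun w => h @: [set e] \subset w)); last first.
    by move=> w; rewrite imset_set1 sub1set.
  by rewrite prob_subset // weight_h cards1.
have := @prob_deviation _ _ p p_ge0 p_le1 _ (fun e w => h e \in w)
  (N%:R * q) d Q d0.
rewrite -/N => H; apply: le_trans (H _) _ => [w /Qd|]; first by rewrite sizeE.
have -> : \sum_e Prob (fun w => h e \in w) = N%:R * q.
  by under eq_bigr do rewrite prob1; rewrite sumr_const mulr_natl.
have : \sum_e \sum_e' Prob (fun w => (h e \in w) && (h e' \in w)) <=
    N%:R * (q + N%:R * q ^+ 2).
  rewrite mulr_natl -sumr_const; apply: ler_sum => e _.
  rewrite (bigD1 e) //= (@eq_prob _ _ _ _ (fun w => h e \in w)) ?prob1; last first.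
    by move=> w; rewrite andbb.
  rewrite lerD2l; apply: (@le_trans _ _ (\sum_(e' | e' != e) q ^+ 2)).
    apply: ler_sum => e' ee'.
    rewrite (@eq_prob _ _ _ _ (fun w => h @: [set e; e'] \subset w)).
      by rewrite prob_subset // weight_h cards2 eq_sym ee'.
    by move=> w; rewrite imsetU1 imset_set1 subUset !sub1set.
  rewrite sumr_const -[leLHS]mulr_natl ler_wpM2r ?sqr_ge0 // ler_nat max_card //.
nra.
Qed.

End RandomGraph.

Lemma ffact_leq_exp (m k : nat) : (m ^_ k <= m ^ k)%N.
Proof.
elim: k m => [|k IH] m //; rewrite ffactnS expnS leq_mul2l; apply/orP; right.
apply: leq_trans (IH _) _; case: k {IH} => // k.
by rewrite leq_exp2r // leq_pred.
Qed.

Lemma bin_leq_exp (m k : nat) : ('C(m, k) <= m ^ k)%N.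
Proof.
apply: leq_trans (ffact_leq_exp m k); rewrite -bin_ffact.
by rewrite leq_pmulr ?fact_gt0.
Qed.

Section TriangleEvents.
Variables (R : realFieldType) (T J : finType) (h : edge T -> J) (p : J -> R) (q : R).
Hypotheses (p_ge0 : forall j, 0 <= p j) (p_le1 : forall j, p j <= 1).
Hypotheses (h_inj : injective h) (p_h : forall e, p (h e) = q).
Hypotheses (q_ge0 : 0 <= q) (q_le1 : q <= 1).
Implicit Types (S U : {set T}) (L : {set {set T}}) (w : {set J}) (A : {set edge T}).
Notation n := #|T|.
Notation Prob := (prob p).
Hypothesis nq_le1 : 3 * n%:R * q ^+ 2 <= 1.

Definition janson_base : R := 1 - (1 - 3 * n%:R * q ^+ 2) * q ^+ 3.

Lemma janson_base_ge0 : 0 <= janson_base.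
Proof.
rewrite subr_ge0 mulr_ile1 ?exprn_ge0 ?subr_ge0 ?exprn_ile1 //.
by rewrite lerBlDr lerDl !mulr_ge0.
Qed.

Lemma janson_base_le1 : janson_base <= 1.
Proof. by rewrite lerBlDr lerDl mulr_ge0 ?exprn_ge0 ?subr_ge0. Qed.

Lemma in_triangle_no_clique A u :
  in_triangle A u <-> ~~ no_clique (crossing [set u]) A.
Proof.
rewrite in_triangleP; split=> [[S uS /andP[S3 SA]]|].
  rewrite negb_forall_in; apply/exists_inP; exists S; last by rewrite negbK.
  by rewrite mem_crossing1 S3.
rewrite negb_forall_in => /exists_inP[S]; rewrite mem_crossing1 negbK.
by move=> /andP[S3 uS] SA; exists S => //; rewrite /triangle S3.
Qed.

Lemma all_in_triangle_no_clique A :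
  all_in_triangle A <-> forall u, ~~ no_clique (crossing [set u]) A.
Proof. by split=> At u; apply/in_triangle_no_clique. Qed.

Lemma crossing3 U S : S \in crossing U -> #|S| = 3%N.
Proof. by rewrite inE => /andP[/eqP]. Qed.

Lemma prob_no_clique_crossing U :
  Prob (fun w => no_clique (crossing U) (h @^-1: w)) <=
    janson_base ^+ (#|U| * 'C(#|~: U|, 2)).
Proof.
have := prob_no_triangle_le p_ge0 p_le1 h_inj p_h (@crossing3 U) nq_le1 q_ge0.
move/le_trans; apply; apply: ler_wiXn2l; first exact: janson_base_ge0.
  exact: janson_base_le1.
exact: card_crossing_ge.
Qed.

Lemma prob_not_all_in_triangle :
  Prob (fun w => ~~ `[< all_in_triangle (h @^-1: w) >]) <=
    n%:R * janson_base ^+ 'C(n.-1, 2).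
Proof.
apply: (@le_trans _ _ (\sum_u Prob (fun w => no_clique (crossing [set u]) (h @^-1: w)))).
  apply: (@prob_sum _ _ _ p_ge0 p_le1 T xpredT) => w.
  move=> /asboolPn nw; apply: contrapT => nu; apply: nw.
  apply/all_in_triangle_no_clique => u; apply/negP => nc; apply: nu; by exists u.
rewrite mulr_natl -sumr_const; apply: ler_sum => u _.
by have := prob_no_clique_crossing [set u]; rewrite cards1 mul1n cardsC1.
Qed.

(* Second moment method for the number of vertices in no triangle. *)
Lemma prob_all_in_triangle (l := n%:R * (1 - q ^+ 3) ^+ 'C(n.-1, 2)) : 1 <= l ->
  Prob (fun w => `[< all_in_triangle (h @^-1: w) >]) * l ^+ 2 <=
    l + n%:R ^+ 2 * janson_base ^+ (2 * 'C(n.-1, 2) - n) - l ^+ 2.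
Proof.
move=> l1; set b := janson_base ^+ _; set Q := fun w => _.
pose X u w := no_clique (crossing [set u]) (h @^-1: w).
set c := \sum_u Prob (X u).
have cl : l <= c.
  rewrite /l mulr_natl -sumr_const; apply: ler_sum => u _.
  have := prob_no_triangle_ge p_ge0 p_le1 h_inj p_h (@crossing3 [set u]).
  by rewrite card_crossing1.
have c0 : 0 <= c by apply: le_trans cl; apply: le_trans l1.
have Qc w : Q w -> c <= `|(\sum_u X u w)%:R - c|.
  move=> /asboolP/all_in_triangle_no_clique Qw.
  by rewrite big1 ?sub0r ?normrN ?ler_norm // => u _; rewrite /X (negbTE (Qw u)).
have := prob_deviation p_ge0 p_le1 c0 Qc; rewrite -/c => dev.
have pairs : \sum_u \sum_v Prob (fun w => X u w && X v w) <= c + n%:R ^+ 2 * b.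
  have -> : n%:R ^+ 2 * b = \sum_(u : T) n%:R * b.
    by rewrite sumr_const -[RHS]mulr_natl expr2 mulrA.
  rewrite -big_split /=; apply: ler_sum => u _.
  rewrite (bigD1 u) //= (@eq_prob _ _ _ _ (X u)); last by move=> w; rewrite andbb.
  rewrite lerD2l; apply: (@le_trans _ _ (\sum_(v | v != u) b)); last first.
    rewrite sumr_const -[leLHS]mulr_natl ler_wpM2r ?exprn_ge0 ?janson_base_ge0 //.
    by rewrite ler_nat max_card.
  apply: ler_sum => v vu.
  apply: (@le_trans _ _ (Prob (fun w => no_clique (crossing [set u] :|: crossing [set v])
      (h @^-1: w)))).
    apply: le_prob => // w /andP[/forall_inP Xu /forall_inP Xv].
    by apply/forall_inP => S; rewrite inE => /orP[/Xu|/Xv].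
  have := @prob_no_triangle_le _ _ _ h p q p_ge0 p_le1 h_inj p_h
    (crossing [set u] :|: crossing [set v]) _ nq_le1 q_ge0.
  move=> H; apply: le_trans (H _) _; first by move=> S; rewrite inE => /orP[]/crossing3.
  apply: ler_wiXn2l; [exact: janson_base_ge0|exact: janson_base_le1|].
  by have := @card_crossingU _ u v; rewrite eq_sym => /(_ vu); lia.
set P := Prob Q in dev *; have P0 : 0 <= P by apply: prob_ge0.
(* [dev] involves the true mean [c]. As [(P + 1) * c ^+ 2 - c] increases for [c] at least 1, [c] may
   be lowered to its Harris bound [l]. *)
clearbody l; have : 0 <= (c - l) * ((P + 1) * (c + l) - 1).
  by rewrite mulr_ge0 ?subr_ge0 //; nra.
nra.
Qed.

Lemma prob_not_joined m :
  Prob (fun w => ~~ joined (h @^-1: w) m) <= 4 ^+ n * (1 - q) ^+ (m ^ 2).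
Proof.
pose cut (SU : {set T} * {set T}) := [set P : {set T} |
  (#|P| == 2%N) && (#|P :&: SU.1| == 1%N) && (#|P :&: SU.2| == 1%N)].
pose big (SU : {set T} * {set T}) :=
  [disjoint SU.1 & SU.2] && (m <= #|SU.1|)%N && (m <= #|SU.2|)%N.
apply: (@le_trans _ _ (\sum_(SU | big SU)
    Prob (fun w => no_clique (cut SU) (h @^-1: w)))).
  apply: (@prob_sum _ _ _ p_ge0 p_le1) => w.
  rewrite negb_forall => /existsP[S]; rewrite negb_forall => /existsP[U].
  rewrite negb_imply => /andP[SU nadj]; exists (S, U) => //.
  apply/forall_inP => P; rewrite inE /= => /andP[/andP[P2 PS] PU].
  apply: contra nadj => /subsetP Pw.
  have /cards1P[x /setP xE] := PS; have /cards1P[y /setP yE] := PU.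
  have := xE x; rewrite !inE eqxx => /andP[xP xS].
  have := yE y; rewrite !inE eqxx => /andP[yP yU].
  have xy : x != y.
    apply/eqP => xy; move: SU => /andP[/andP[/pred0P/(_ x) /= + _] _].
    by rewrite xS xy yU.
  have [e exy] := edge_exists xy.
  apply/exists_inP; exists x => //; apply/exists_inP; exists y => //.
  apply/adjP; exists e => //; apply: Pw.
  by rewrite inE exy subUset !sub1set xP yP.
apply: (@le_trans _ _ (\sum_(SU | big SU) (1 - q) ^+ (m ^ 2))).
  apply: ler_sum => -[S U] /andP[/andP[/= dis mS] mU].
  apply: le_trans (prob_no_edge_le p_ge0 p_le1 h_inj p_h _ q_ge0) _.
    by move=> P; rewrite inE => /andP[/andP[/eqP]].
  apply: ler_wiXn2l; rewrite ?subr_ge0 // ?lerBlDr ?lerDl //.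
  by apply: leq_trans (card_cut dis); rewrite expnS expn1 leq_mul.
rewrite sumr_const -[leLHS]mulr_natl ler_wpM2r ?exprn_ge0 ?subr_ge0 //.
rewrite -natrX ler_nat; apply: leq_trans (max_card _) _.
by rewrite card_prod -cardsT -powersetT card_powerset cardsT -expnMn.
Qed.

End TriangleEvents.

Section TwoRounds.
Variables (R : realType) (T : finType).
Notation E := (edge T).
Implicit Types (U : {set T}) (w : {set (E + E)}).
Notation n := #|T|.

(* Two independent random graphs, indexed by [inl] and [inr]: the pair
   ([round1 w], [rounds w]) stands for the process at two times. *)
Definition round_weight (pA pB : R) (j : E + E) : R :=
  match j with inl _ => pA | inr _ => pB end.

Definition round1 w : {set E} := inl @^-1: w.
Definition rounds w : {set E} := inl @^-1: w :|: inr @^-1: w.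

(** [uphalf #|U|] is the least possible number of edges inside [U] when each vertex of [U] has a
    neighbour there; only this count is retained. *)
Definition inner_edges U (A : {set E}) : bool :=
  (uphalf #|U| <= #|clique U :&: A|)%N.

Variables (pA pB : R).
Hypotheses (pA0 : 0 <= pA) (pAB : pA <= pB) (pB1 : pB <= 1).
Notation Prob := (prob (round_weight pA pB)).

Lemma round_weight_ge0 j : 0 <= round_weight pA pB j.
Proof. by case: j => _ //=; apply: le_trans pAB. Qed.

Lemma round_weight_le1 j : round_weight pA pB j <= 1.
Proof. by case: j => _ //=; apply: le_trans pB1. Qed.

(** Union bound over sets of [uphalf #|U|] coordinates: the two rounds together offer at most
    [#|U| ^ 2] coordinates inside [U], each present with probability at most [pB]. Harris'
    inequality splits off the decreasing event [D]. *)
Lemma prob_inner_edges U (D : pred {set (E + E)}) :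
  (forall j w, D (j |: w) -> D w) ->
  Prob (fun w => inner_edges U (rounds w) && D w) <=
    (#|U|%:R ^+ 2 * pB) ^+ uphalf #|U| * Prob D.
Proof.
move=> Danti; set k := uphalf _.
pose UU : {set (E + E)} := inl @: clique U :|: inr @: clique U.
pose good (W : {set (E + E)}) := (W \subset UU) && (#|W| == k).
apply: (@le_trans _ _ (\sum_(W | good W) Prob (fun w => (W \subset w) && D w))).
  apply: prob_sum => [||w /andP[/card_geqP[s [us sk sU]] Dw]].
  - exact: round_weight_ge0.
  - exact: round_weight_le1.
  (* An inner edge may come from either round; [f] picks a copy that is present. *)
  pose f (e : E) : E + E := if inl e \in w then inl e else inr e.
  have f_inj : injective f.
    by move=> e e'; rewrite /f; case: ifP; case: ifP => // _ _ [].
  exists (f @: [set:: s]).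
    apply/andP; split; last by rewrite card_imset // cardsE (card_uniqP us) sk.
    apply/subsetP => _ /imsetP[e es ->].
    have := sU e; rewrite inE in es; rewrite es => /(_ isT); rewrite !inE => /andP[eU _].
    rewrite /f; case: ifP => _; apply/orP; [left|right]; apply: imset_f; by rewrite inE.
  rewrite Dw andbT; apply/subsetP => _ /imsetP[e es ->].
  have := sU e; rewrite inE in es; rewrite es => /(_ isT); rewrite !inE => /andP[_].
  by rewrite /f; case: ifP => //= ->.
apply: (@le_trans _ _ (\sum_(W | good W) pB ^+ k * Prob D)).
  apply: ler_sum => W /andP[_ /eqP Wk].
  apply: le_trans (prob_subset_antitone round_weight_ge0 round_weight_le1 W Danti) _.
  rewrite ler_wpM2r ?prob_ge0 //; [exact: round_weight_ge0|exact: round_weight_le1|].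
  rewrite -Wk -prodr_const; apply: ler_prod => -[e|e] _ /=; rewrite ?pA0 ?pAB ?lexx ?andbT //.
  exact: le_trans pAB.
rewrite sumr_const -[leLHS]mulr_natl mulrA ler_wpM2r ?prob_ge0 //.
- exact: round_weight_ge0.
- exact: round_weight_le1.
rewrite exprMn ler_wpM2r ?exprn_ge0 //; first exact: le_trans pAB.
rewrite -natrX -natrX ler_nat -[X in (X <= _)%N]cardsE.
have -> : [set W | good W] = [set W : {set (E + E)} | W \subset UU & #|W| == k].
  by [].
rewrite cards_draws; apply: (@leq_trans (#|UU| ^ k)).
  exact: bin_leq_exp.
rewrite -expnM; apply: leq_trans (_ : (#|U| ^ 2) ^ k <= _)%N; last by rewrite expnM.
case: (posnP k) => [->//|k0]; rewrite leq_exp2r //.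
apply: leq_trans (leq_card_setU _ _) _.
rewrite !card_imset; try by move=> ? ? [].
rewrite card_clique addnn -muln2.
by have := ffact_leq_exp #|U| 2; rewrite -bin_ffact.
Qed.

End TwoRounds.

(** * From the process to product measures *)

Section BadSet.
Variable T : finType.
Implicit Types (U : {set T}) (A B C : {set edge T}).

(* What the complement [U] of a huge row or column leaves behind; [B] and [C] are
   the graphs shortly before and after all vertices are covered by triangles. *)
Definition bad_set K B C : bool :=
  [exists U : {set T}, [&& (0 < #|U| <= K)%N, inner_edges U C & no_clique (crossing U) B]].

Lemma no_clique_antitone (L : {set {set T}}) B B' :
  B' \subset B -> no_clique L B -> no_clique L B'.
Proof.
move=> BB /forall_inP LB; apply/forall_inP => S /LB; apply: contra => SB.
exact: subset_trans SB BB.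
Qed.

(** This is the monotonicity that [Pr_le_exchangeable] requires. *)
Lemma bad_set_mono K B B' C C' :
  B' \subset B -> C \subset C' -> bad_set K B C -> bad_set K B' C'.
Proof.
move=> BB CC /existsP[U /and3P[UK UC UB]]; apply/existsP; exists U.
rewrite UK (no_clique_antitone BB UB) andbT; apply: leq_trans UC _.
by apply: subset_leq_card; apply: setIS.
Qed.

Lemma inner_edges_cover U A :
  (forall u, u \in U -> exists2 v, v \in U & adj A u v) -> inner_edges U A.
Proof.
move=> UA; rewrite /inner_edges leq_uphalf_double -muln2.
have /subset_leq_card/leq_trans : U \subset \bigcup_(e in clique U :&: A) val e.
  apply/subsetP => u uU; have [v vU /adjP[e eA euv]] := UA u uU.
  apply/bigcupP; exists e; last by rewrite euv !inE eqxx.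
  by rewrite !inE eA euv subUset !sub1set uU vU.
apply; apply: leq_trans (_ : \sum_(e in clique U :&: A) #|val e| <= _)%N.
  elim/big_rec2: _ => [|e s S _ IH]; first by rewrite cards0.
  by apply: leq_trans (leq_card_setU _ _) _; rewrite leq_add2l.
rewrite -sum_nat_const leq_sum // => e _.
by have /eqP -> := valP e.
Qed.

(** Inner edges of [G] persist in [C], and triangles of [A] are triangles of [G]: the graph at the
    random time is eliminated in favour of two fixed times. *)
Lemma bad_set_of_triangle_free K U (A G C : {set edge T}) :
  A \subset G -> G \subset C -> all_in_triangle G -> (0 < #|U| <= K)%N ->
  (forall S, triangle G S -> #|S :&: U| <> 1%N) -> bad_set K A C.
Proof.
move=> AG GC Gt UK US; apply/existsP; exists U; rewrite UK /=; apply/andP; split.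
  apply: inner_edges_cover => u uU; have /in_triangleP[S uS SG] := Gt u.
  have : (1 < #|S :&: U|)%N.
    have : (0 < #|S :&: U|)%N by apply/card_gt0P; exists u; rewrite inE uS.
    have := US S SG; lia.
  rewrite (cardsD1 u) inE uS uU /= ltnS => /card_gt0P[v].
  rewrite !inE => /andP[vu /andP[vS vU]]; exists v => //.
  by apply: adj_mono GC _; apply: triangle_adj SG _ _ _ => //; rewrite eq_sym.
apply/forall_inP => S; rewrite inE => /andP[S3 /eqP SU]; apply/negP => SA.
by apply: US SU; rewrite /triangle S3 (subset_trans SA).
Qed.

End BadSet.

(** * The deterministic criterion for equality of the hitting times *)

Section HittingTimes.
Variable n : nat.
Implicit Types (w : outcome n).

Lemma hitting_time_eq w (P Q : {set edge 'I_n} -> Prop) :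
  (forall A, P A -> Q A) -> (hitting_time Q w <= 'C(n, 2))%N ->
  P (process w (hitting_time Q w)) -> hitting_time P w = hitting_time Q w.
Proof.
move=> PQ tN Pt; set t := hitting_time Q w in tN Pt *.
have nthE i : (i <= 'C(n, 2))%N -> nth 0%N (iota 0 ('C(n, 2)).+1) i = i.
  by move=> iN; rewrite nth_iota.
apply/eqP; rewrite eqn_leq; apply/andP; split; rewrite leqNgt; apply/negP => lt.
  have := before_find 0%N lt; rewrite nthE //.
  by move/asboolPn; apply.
have pN : (hitting_time P w <= 'C(n, 2))%N by apply: leq_trans (ltnW lt) tN.
have /(nth_find 0%N) : has (fun t => `[< P (process w t) >]) (iota 0 ('C(n, 2)).+1).
  by rewrite has_find size_iota ltnS.
rewrite -/(hitting_time P w) nthE // => /asboolP/PQ Qp.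
have := before_find 0%N lt; rewrite nthE //.
by move/asboolPn; apply.
Qed.

Lemma tau_eq w (t u m : nat) :
  (2 < n)%N -> (0 < m)%N -> (2 * m <= n)%N -> (u <= 'C(n, 2))%N ->
  ~ all_in_triangle (process w t) -> all_in_triangle (process w u) ->
  joined (process w t) m -> ~~ bad_set (4 * m) (process w t) (process w u) ->
  tau_NAC w = tau_triangle w.
Proof.
move=> n3 m0 mn uN nt au jt nbad.
have nthE i : (i <= 'C(n, 2))%N -> nth 0%N (iota 0 ('C(n, 2)).+1) i = i.
  by move=> iN; rewrite nth_iota.
set a := tau_triangle w.
have au' : (a <= u)%N.
  rewrite leqNgt; apply/negP => lt; have := before_find 0%N lt; rewrite nthE //.
  by move/asboolPn; apply.
have aN : (a <= 'C(n, 2))%N by apply: leq_trans uN.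
have At : all_in_triangle (process w a).
  have /(nth_find 0%N) : has (fun t => `[< all_in_triangle (process w t) >])
      (iota 0 ('C(n, 2)).+1) by rewrite has_find size_iota ltnS.
  by rewrite -/(hitting_time _ w) -/(tau_triangle w) nthE // => /asboolP.
have ta : (t <= a)%N.
  rewrite leqNgt; apply/negP => lt; apply: nt.
  by apply: all_in_triangle_mono At; apply/process_mono/ltnW.
apply: hitting_time_eq => // [A|]; first by apply: connected_no_NAC_triangle; rewrite card_ord.
apply: contrapT => nN; case/negP: nbad.
have [|U UK US] := @not_connected_no_NAC _ _ m _ (process_mono w ta) jt m0 _ nN.
  by rewrite card_ord.
by apply: bad_set_of_triangle_free UK US => //; apply: process_mono.
Qed.

End HittingTimes.

Lemma mass_imset (R : realFieldType) (J : finType) (p : J -> R) (f : J -> J) (w : {set J}) :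
  injective f -> (forall j, p (f j) = p j) -> mass p (f @: w) = mass p w.
Proof.
move=> finj pf; rewrite /mass (reindex_inj finj) /=; apply: eq_bigr => j _.
by rewrite mem_imset // pf.
Qed.

Section Deviation.
Variables (R : realFieldType) (T J : finType) (h : edge T -> J) (p : J -> R) (q : R).
Hypotheses (p_ge0 : forall j, 0 <= p j) (p_le1 : forall j, p j <= 1).
Hypotheses (h_inj : injective h) (p_h : forall e, p (h e) = q).
Notation N := #|edge T|.
Variable d : R.
Hypotheses (d_gt0 : 0 < d) (d_big : 4 * (N%:R * q) <= d ^+ 2).

(** At most two tails of 1/4 each leave the edge counts correct with probability at least 1/2; hence
    the factor 2 in the transfer to product measures. *)
Lemma prob_deviation_quarter (Q : pred {set J}) :
  (forall w, Q w -> d <= `|#|h @^-1: w|%:R - N%:R * q|) -> prob p Q <= 4^-1.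
Proof.
move=> Qd; have := prob_edges_deviation p_ge0 p_le1 h_inj p_h (ltW d_gt0) Qd.
have dd : 0 < d ^+ 2 by rewrite exprn_gt0.
move=> PQ; rewrite -(ler_pM2r dd); apply: le_trans PQ _; move: d_big; lra.
Qed.

Lemma prob_edges_gt (t : nat) : N%:R * q + d <= t%:R ->
  prob p (fun w => ~~ (#|h @^-1: w| <= t)%N) <= 4^-1.
Proof.
move=> tq; apply: prob_deviation_quarter => w; rewrite -ltnNge => tw.
apply: le_trans (ler_norm _); rewrite lerBrDl; apply: le_trans tq _.
by rewrite ler_nat ltnW.
Qed.

Lemma prob_edges_lt (t : nat) : t%:R + d <= N%:R * q ->
  prob p (fun w => ~~ (t <= #|h @^-1: w|)%N) <= 4^-1.
Proof.
move=> tq; apply: prob_deviation_quarter => w; rewrite -ltnNge => tw.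
rewrite distrC; apply: le_trans (ler_norm _); rewrite lerBrDr; apply: le_trans tq.
by rewrite addrC lerD2r ler_nat ltnW.
Qed.

End Deviation.

(** * Comparison of the process at fixed times with product measures *)

Section Transfer.
Variables (R : realType) (n : nat).
Notation E := (edge 'I_n).
Notation N := ('C(n, 2)).
Implicit Types (q d : R) (t u : nat).

Lemma le_twice (x y z : R) : 0 <= x -> x * y <= z -> 2^-1 <= y -> x <= 2 * z.
Proof. by move=> *; nra. Qed.

Lemma half_le (y : R) : 1 - y <= 4^-1 + 4^-1 -> 2^-1 <= y.
Proof. by move=> *; lra. Qed.

Lemma Pr_monotone_le (Q : {set E} -> bool) q d t :
  0 <= q <= 1 -> 0 < d -> 4 * (N%:R * q) <= d ^+ 2 -> t%:R + d <= N%:R * q ->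
  (forall B B' : {set E}, B \subset B' -> Q B -> Q B') ->
  Pr R (fun w : outcome n => Q (process w t)) <= 2 * prob (fun _ : E => q) Q.
Proof.
move=> /andP[q0 q1] d0 dN tq Qmono; rewrite -card_edge in dN tq.
apply: (le_twice (Pr_ge0 _ _)
  (* With [N] as the first time, the upper bound on the size holds for every graph. *)
  (@Pr_le_exchangeable R n {set E} (mass (fun=> q)) id id (fun _ => Q) N t
  (fun s w => s @: w) _ _ _ _ _ _ _)) => //.
- by move=> w; apply: mass_ge0.
- by move=> s; apply/imset_inj/perm_inj.
- by move=> s w; apply: mass_imset => //; apply: perm_inj.
- by move=> B B' D D' _; apply: Qmono.
have := @prob_edges_lt R _ _ id (fun _ : E => q) q (fun=> q0) (fun=> q1) (@inj_id _)
  (fun=> erefl) d d0 dN t tq.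
rewrite (@probC _ _ (fun=> q) (fun w : {set E} => (t <= #|id @^-1: w|)%N)).
have -> : prob (fun=> q) (fun w : {set E} => (t <= #|id @^-1: w|)%N) =
    \sum_(w : {set E} | (#|w| <= N)%N && (t <= #|w|)%N) mass (fun=> q) w.
  apply: eq_bigl => w; rewrite -card_edge max_card /=; congr (_ <= _)%N.
  by apply: eq_card => e; rewrite inE.
by move=> ?; lra.
Qed.

Lemma Pr_antitone_le (Q : {set E} -> bool) q d t :
  0 <= q <= 1 -> 0 < d -> 4 * (N%:R * q) <= d ^+ 2 -> N%:R * q + d <= t%:R ->
  (forall B B' : {set E}, B' \subset B -> Q B -> Q B') ->
  Pr R (fun w : outcome n => Q (process w t)) <= 2 * prob (fun _ : E => q) Q.
Proof.
move=> /andP[q0 q1] d0 dN tq Qmono; rewrite -card_edge in dN tq.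
apply: (le_twice (Pr_ge0 _ _)
  (@Pr_le_exchangeable R n {set E} (mass (fun=> q)) id id (fun B _ => Q B) t 0%N
  (fun s w => s @: w) _ _ _ _ _ _ _)) => //.
- by move=> w; apply: mass_ge0.
- by move=> s; apply/imset_inj/perm_inj.
- by move=> s w; apply: mass_imset => //; apply: perm_inj.
- by move=> B B' D D' BB _; apply: Qmono.
have := @prob_edges_gt R _ _ id (fun _ : E => q) q (fun=> q0) (fun=> q1) (@inj_id _)
  (fun=> erefl) d d0 dN t tq.
rewrite (@probC _ _ (fun=> q) (fun w : {set E} => (#|id @^-1: w| <= t)%N)).
have -> : prob (fun=> q) (fun w : {set E} => (#|id @^-1: w| <= t)%N) =
    \sum_(w : {set E} | (#|w| <= t)%N && (0 <= #|w|)%N) mass (fun=> q) w.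
  apply: eq_bigl => w; rewrite /= andbT; congr (_ <= _)%N.
  by apply: eq_card => e; rewrite inE.
by move=> ?; lra.
Qed.

Lemma Pr_two_times_le (Q : {set E} -> {set E} -> bool) (pA pB d : R) t u :
  0 <= pA -> pA <= pB -> pB <= 1 -> 0 < d -> 4 * (N%:R * pB) <= d ^+ 2 ->
  N%:R * pA + d <= t%:R -> u%:R + d <= N%:R * pB ->
  (forall B B' D D' : {set E}, B' \subset B -> D \subset D' -> Q B D -> Q B' D') ->
  Pr R (fun w : outcome n => Q (process w t) (process w u)) <=
    2 * prob (round_weight pA pB) (fun w => Q (round1 w) (rounds w)).
Proof.
move=> pA0 pAB pB1 d0 dN tA uB Qmono; rewrite -card_edge in dN tA uB.
pose sm (s : {perm E}) (j : E + E) : E + E :=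
  match j with inl e => inl (s e) | inr e => inr (s e) end.
have sm_inj s : injective (sm s) by move=> [e|e] [e'|e'] //= [] /perm_inj ->.
have W0 := @round_weight_ge0 R 'I_n pA pB pA0 pAB.
have W1 := @round_weight_le1 R 'I_n pA pB pAB pB1.
have sm1 s (w : {set (E + E)}) : round1 (sm s @: w) = s @: round1 w.
  apply/setP => e; rewrite inE; apply/imsetP/imsetP => [[[e'|e'] ew //= [->]]|[e' ew ->]].
    by exists e' => //; rewrite inE.
  by exists (inl e') => //; rewrite inE in ew.
have sm2 s (w : {set (E + E)}) : rounds (sm s @: w) = s @: rounds w.
  rewrite /rounds imsetU -sm1; congr (_ :|: _).
  apply/setP => e; rewrite inE; apply/imsetP/imsetP => [[[e'|e'] ew //= [->]]|[e' ew ->]].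
    by exists e' => //; rewrite inE.
  by exists (inr e') => //; rewrite inE in ew.
apply: (le_twice (Pr_ge0 _ _)
  (@Pr_le_exchangeable R n {set (E + E)} (mass (round_weight pA pB))
  (@round1 _) (@rounds _) Q t u
  (fun s w => sm s @: w) _ _ _ _ sm1 sm2 Qmono)) => //.
- by move=> w; apply: mass_ge0.
- by move=> w; apply: subsetUl.
- by move=> s; apply/imset_inj/sm_inj.
- by move=> s w; apply: mass_imset => //; case.
have inl_inj : injective (@inl E E) by move=> ? ? [].
have inr_inj : injective (@inr E E) by move=> ? ? [].
have dA : 4 * (#|E|%:R * pA) <= d ^+ 2.
  by apply: le_trans dN; rewrite ler_pM2l // ler_wpM2l.
have tail1 := prob_edges_gt W0 W1 inl_inj (fun=> erefl) d0 dA tA.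
(* The second round alone already has [u] edges, which bounds the size of the union from below. *)
have tail2 := prob_edges_lt W0 W1 inr_inj (fun=> erefl) d0 dN uB.
suff : 1 - prob (round_weight pA pB)
   (fun w : {set (E + E)} => (#|round1 w| <= t)%N && (u <= #|rounds w|)%N) <= 4^-1 + 4^-1.
  exact: half_le.
rewrite -probC.
apply: le_trans (lerD tail1 tail2).
rewrite (@probID _ _ _ (fun w => ~~ (#|round1 w| <= t)%N)); apply: lerD.
  by apply: le_prob => // w /andP[].
apply: le_prob => // w; rewrite negbK => /andP[]; rewrite negb_and => + wt.
rewrite wt /=; apply: contra => /leq_trans; apply.
by apply: subset_leq_card; apply: subsetUr.
Qed.

End Transfer.

Lemma geometric_le (R : realFieldType) (x : R) (K : nat) :
  0 <= x -> x <= 2^-1 -> \sum_(k < K) x ^+ k.+1 <= 2 * x.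
Proof.
move=> x0 x2; under eq_bigr do rewrite exprS.
rewrite -mulr_sumr mulrC ler_wpM2r //.
have := subrX1 x K; have := exprn_ge0 K x0; set s := \sum_(_ < _) _; set y := x ^+ K.
by move=> ? e; have : (1 - x) * s <= 1 by [rewrite -[1 - x]opprB mulNr -e; lra]; nra.
Qed.

Section BadSetProbability.
Variables (R : realType) (T : finType) (pA pB x : R) (K : nat).
Notation n := #|T|.
Hypotheses (pA0 : 0 <= pA) (pAB : pA <= pB) (pB1 : pB <= 1).
Hypotheses (nq_le1 : 3 * n%:R * pA ^+ 2 <= 1) (x0 : 0 <= x) (x2 : x <= 2^-1).
Hypothesis bound : forall k, (0 < k <= K)%N ->
  'C(n, k)%:R * (Num.min ((k%:R ^+ 2 * pB) ^+ uphalf k) 1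
    * janson_base T pA ^+ (k * 'C(n - k, 2))) <= x ^+ k.

(** Union bound over [U], grouped by size. The minimum with 1 in [bound] drops the factor for inner
    edges wherever it exceeds 1. *)
Lemma prob_bad_set :
  prob (round_weight pA pB) (fun w : {set (edge T + edge T)} =>
    bad_set K (round1 w) (rounds w)) <= 2 * x.
Proof.
have W0 := @round_weight_ge0 R T pA pB pA0 pAB.
have W1 := @round_weight_le1 R T pA pB pAB pB1.
have pA1 : pA <= 1 by apply: le_trans pB1.
pose bad (U : {set T}) (w : {set (edge T + edge T)}) :=
  inner_edges U (rounds w) && no_clique (crossing U) (round1 w).
apply: le_trans (geometric_le K x0 x2).
apply: (@le_trans _ _ (\sum_(k < K) prob (round_weight pA pB)
   (fun w => [exists U : {set T}, (#|U| == k.+1) && bad U w]))).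
  apply: (@prob_sum _ _ _ W0 W1 _ xpredT) => w /existsP[U /and3P[/andP[U0 UK] UC UB]].
  have Uk : (#|U|.-1 < K)%N by rewrite prednK.
  exists (Ordinal Uk) => //; apply/existsP; exists U.
  by rewrite /= prednK // eqxx /bad UC UB.
apply: ler_sum => k _; have kK : (0 < k.+1 <= K)%N by exact: ltn_ord.
apply: le_trans (bound kK).
apply: (@le_trans _ _ (\sum_(U in [set U : {set T} | #|U| == k.+1])
    prob (round_weight pA pB) (bad U))).
  apply: (@prob_sum _ _ _ W0 W1) => w /existsP[U /andP[Uk Uw]].
  by exists U; rewrite ?inE.
rewrite -(card_draws T k.+1) mulr_natl -sumr_const; apply: ler_sum => U.
rewrite inE => /eqP Uk.
have inl_inj : injective (@inl (edge T) (edge T)) by move=> ? ? [].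
have free := prob_no_clique_crossing W0 W1 inl_inj (fun=> erefl) pA0 pA1 nq_le1 U.
rewrite [#|~: U|]cardsCs setCK Uk in free.
have D0 : 0 <= prob (round_weight pA pB) (fun w => no_clique (crossing U) (round1 w)).
  exact: prob_ge0.
have J0 := janson_base_ge0 pA0 pA1 nq_le1.
rewrite minEle; case: ifP => _; last first.
  rewrite mul1r; apply: le_trans free; apply: le_prob => // w /andP[_ //].
have anti j (w : {set (edge T + edge T)}) :
    no_clique (crossing U) (round1 (j |: w)) -> no_clique (crossing U) (round1 w).
  by apply: no_clique_antitone; apply: preimsetS; apply: subsetUr.
apply: le_trans (prob_inner_edges pA0 pAB pB1 U anti) _; rewrite Uk.
rewrite ler_wpM2l // exprn_ge0 // mulr_ge0 ?exprn_ge0 //; exact: le_trans pAB.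
Qed.
End BadSetProbability.

Section UnionBound.
Variables (R : realType) (n m t u : nat).

Lemma Pr_tau_neq : (2 < n)%N -> (0 < m)%N -> (2 * m <= n)%N -> (u <= 'C(n, 2))%N ->
  1 - Pr R (fun w : outcome n => tau_NAC w == tau_triangle w) <=
  Pr R (fun w : outcome n => `[< all_in_triangle (process w t) >]) +
  (Pr R (fun w : outcome n => ~~ `[< all_in_triangle (process w u) >]) +
  (Pr R (fun w : outcome n => ~~ joined (process w t) m) +
   Pr R (fun w : outcome n => bad_set (4 * m) (process w t) (process w u)))).
Proof.
move=> n3 m0 mn uN; rewrite -PrC.
apply: le_trans (lerD (lexx _) (lerD (lexx _) (PrU _ _ _))).
apply: le_trans (lerD (lexx _) (PrU _ _ _)).
apply: le_trans (PrU _ _ _); apply: le_Pr => w _ neq.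
apply/or4P; apply: contrapT => nor; case/negP: neq; apply/eqP.
apply: (tau_eq n3 m0 mn uN).
- by move=> at_t; apply: nor; constructor 1; apply/asboolP.
- by apply: contrapT => nu; apply: nor; constructor 2; apply/asboolPn.
- by apply: contraT => nj; case: nor; constructor 3.
- by apply/negP => nb; case: nor; constructor 4.
Qed.
End UnionBound.

(** * Asymptotics *)

Section ExpBounds.
Variable R : realType.
Implicit Types (x y : R).

Lemma expR_ge_sqr x : 0 <= x -> (1 + x / 2) ^+ 2 <= expR x.
Proof.
move=> x0; have -> : expR x = expR (x / 2) ^+ 2.
  by rewrite -expRM_natl; congr expR; field.
by rewrite ler_pXn2r ?nnegrE ?expR_ge0 ?expR_ge1Dx // addr_ge0 // divr_ge0.
Qed.

Lemma onem_exp_le x (k : nat) : x <= 1 -> (1 - x) ^+ k <= expR (- (k%:R * x)).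
Proof.
move=> x1; rewrite -mulrN expRM_natl lerXn2r ?nnegrE ?expR_ge0 ?subr_ge0 //.
exact: expR_ge1Dx.
Qed.

(** For [x] at most 1/2, [1 + (x + 2 * x ^+ 2)] is at least [(1 - x)^-1], and the exponential is
    larger still. *)
Lemma onem_exp_ge x (k : nat) : 0 <= x -> x <= 2^-1 ->
  expR (- (k%:R * (x + 2 * x ^+ 2))) <= (1 - x) ^+ k.
Proof.
move=> x0 x2; rewrite -mulrN expRM_natl lerXn2r ?nnegrE ?expR_ge0 //; first by lra.
have y0 : 0 < 1 + (x + 2 * x ^+ 2) by nra.
rewrite expRN; apply: (@le_trans _ _ (1 + (x + 2 * x ^+ 2))^-1).
  by rewrite lef_pV2 ?posrE ?expR_gt0 // expR_ge1Dx.
by rewrite -[leLHS]mulr1 ler_pdivrMl //; nra.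
Qed.

Lemma expR_sub1_le x : 0 <= x -> x <= 2^-1 -> expR x - 1 <= 2 * x.
Proof.
move=> x0 x2; have := expR_ge1Dx (- x); rewrite expRN => h.
have e0 := expR_gt0 x; have : (1 - x) * expR x <= 1.
  by rewrite -ler_pdivlMr // div1r.
nra.
Qed.

Lemma expR1_le4 : expR 1 <= 4 :> R.
Proof.
have h := expR_ge1Dx (- 2^-1 : R); rewrite expRN in h.
have e0 := expR_gt0 (2^-1 : R).
have e2 : expR 2^-1 <= 2 :> R.
  have : (1 - 2^-1) * expR 2^-1 <= 1 :> R by rewrite -ler_pdivlMr // div1r.
  lra.
have -> : 1 = 2%:R * 2^-1 :> R by field.
rewrite expRM_natl; nra.
Qed.

(** A crude Stirling bound with 4 in place of e; the induction step is (1 + 1/m)^m <= e. *)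
Lemma expk_le_fact (k : nat) : (k%:R ^+ k <= 4 ^+ k * k`!%:R :> R).
Proof.
elim: k => [|k IH]; first by rewrite !expr0 fact0 mulr1.
case: k IH => [|k] IH; first by rewrite !expr1 mulr1 ler1n.
set m := k.+1 in IH *.
have m0 : 0 < m%:R :> R by rewrite ltr0n.
have step : m.+1%:R ^+ m <= 4 * m%:R ^+ m :> R.
  have mm : 1 = m%:R * m%:R^-1 :> R by rewrite divff ?gt_eqF.
  have -> : m.+1%:R = m%:R * (1 + m%:R^-1) :> R.
    by rewrite mulrDr mulr1 -mm natr1.
  rewrite exprMn mulrC ler_wpM2r ?exprn_ge0 //.
  apply: le_trans expR1_le4; rewrite [in leRHS]mm expRM_natl.
  by rewrite lerXn2r ?nnegrE ?expR_ge0 ?expR_ge1Dx // addr_ge0 // invr_ge0.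
rewrite exprS [4 ^+ m.+1]exprS factS natrM.
rewrite [leRHS](_ : _ = m.+1%:R * (4 * (4 ^+ m * m`!%:R))); last by ring.
rewrite ler_wpM2l // (le_trans step) // ler_wpM2l //.
Qed.

Lemma bin_le_pow (n k : nat) : (0 < k)%N -> 'C(n, k)%:R <= (4 * (n%:R / k%:R)) ^+ k :> R.
Proof.
move=> k0; have kR : 0 < k%:R :> R by rewrite ltr0n.
have f0 : 0 < k`!%:R :> R by rewrite ltr0n fact_gt0.
have h : 'C(n, k)%:R * k`!%:R <= n%:R ^+ k :> R.
  by rewrite -natrM bin_ffact -natrX ler_nat ffact_leq_exp.
rewrite mulrA exprMn exprVn ler_pdivlMr ?exprn_gt0 //.
rewrite -(ler_pM2r f0); have := expk_le_fact k.
move: h; set a := 'C(n, k)%:R; set b := k`!%:R; set c := n%:R ^+ k; set d := k%:R ^+ k.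
rewrite exprMn -/c => h1 h2.
have c0 : 0 <= c by rewrite exprn_ge0.
apply: (@le_trans _ _ (c * d)).
  rewrite mulrAC ler_wpM2r // exprn_ge0 //.
apply: (@le_trans _ _ (c * (4 ^+ k * b))); first by rewrite ler_wpM2l.
by rewrite mulrA [c * _]mulrC.
Qed.

Lemma bin2R (k : nat) : 'C(k, 2)%:R = k%:R * (k%:R - 1) / 2 :> R.
Proof.
case: k => [|k]; first by rewrite mul0r mul0r.
have h : ('C(k.+1, 2) * 2 = k.+1 * k)%N by rewrite (bin_ffact k.+1 2) ffactnS ffactn1.
have h2 : 2%:R != 0 :> R by rewrite pnatr_eq0.
apply: (mulIf h2); rewrite divfK // -natrM h natrM.
by rewrite -[X in _ = _ * (X - 1)]natr1 addrK.
Qed.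

End ExpBounds.

(** * Numerical estimates at densities [a * q], for large n *)

Section Threshold.
Variables (R : realType) (n : nat).
Let L : R := ln n%:R.
Hypothesis L_large : 100 * 100 <= L.

(* At edge density [a * q], a given vertex lies in no triangle with probability
   about n ^ (- a ^ 3 / 2). *)
Definition scale : R := expR ((ln L - 2 * L) / 3).
Notation q := scale.

Lemma natE : n%:R = expR L.
Proof.
rewrite lnK // posrE lt0r ler0n andbT; apply/negP => /eqP n0.
by move: L_large; rewrite /L n0 ln0 //; lra.
Qed.

Lemma L_le_exp : L <= expR (L / 10).
Proof.
apply: (@le_trans _ _ ((1 + (L / 10) / 2) ^+ 2)); first by move: L_large; nra.
by apply: expR_ge_sqr; move: L_large; lra.
Qed.

Lemma lnL_le : ln L <= L / 10.
Proof.
rewrite -ler_expR lnK; first exact: L_le_exp.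
by rewrite posrE; move: L_large; lra.
Qed.

Lemma lnL_ge0 : 0 <= ln L.
Proof. by apply: ln_ge0; move: L_large; lra. Qed.

Lemma q_gt0 : 0 < q.
Proof. exact: expR_gt0. Qed.

(** The equation that [scale] solves: with about n^2 / 2 triples through a vertex, the expected
    number of triangles there at density [a * q] is about a^3 L / 2. *)
Lemma q3n2 : q ^+ 3 * n%:R ^+ 2 = L.
Proof.
rewrite natE -!expRM_natl -expRD.
have -> : 3%:R * ((ln L - 2 * L) / 3) + 2%:R * L = ln L by field.
by rewrite lnK // posrE; move: L_large; lra.
Qed.

(** Weakening the exponent 2/3 to 3/5 absorbs the logarithmic factor of [q]. *)
Lemma q_le : q <= expR (- (3 / 5 * L)).
Proof. by rewrite ler_expR; have := lnL_le; move: L_large; lra. Qed.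

Lemma expRN_le (a c : R) : 0 <= a -> 0 < c -> c <= 1 + a * L -> expR (- (a * L)) <= c^-1.
Proof.
move=> a0 c0 ca; rewrite expRN lef_pV2 ?posrE ?expR_gt0 //.
by apply: le_trans ca _; apply: expR_ge1Dx.
Qed.

Lemma q_small : q <= (100 * 50)^-1.
Proof. by apply: le_trans q_le _; apply: expRN_le; move: L_large; lra. Qed.

Lemma n_large : 100 * 100 <= n%:R :> R.
Proof. by rewrite natE; have := expR_ge1Dx L; move: L_large; lra. Qed.

Lemma nq_large : 100 * 100 * 200 <= n%:R * q.
Proof.
apply: (@le_trans _ _ (expR (L / 3))).
  apply: (@le_trans _ _ ((1 + (L / 3) / 2) ^+ 2)); first by move: L_large; nra.
  by apply: expR_ge_sqr; move: L_large; lra.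
by rewrite natE -expRD ler_expR; have := lnL_ge0; lra.
Qed.

Lemma nq2_le : n%:R * q ^+ 2 <= expR (- (1 / 5 * L)).
Proof.
rewrite natE -expRM_natl -expRD ler_expR; have := lnL_le; move: L_large; lra.
Qed.

Lemma nq2_small : n%:R * q ^+ 2 <= (100 * 10)^-1.
Proof. by apply: le_trans nq2_le _; apply: expRN_le; move: L_large; lra. Qed.

Lemma Lnq2_le : L * (n%:R * q ^+ 2) <= expR (- (1 / 10 * L)).
Proof.
apply: (@le_trans _ _ (expR (L / 10) * expR (- (1 / 5 * L)))).
  apply: ler_pM; [by move: L_large; lra| |exact: L_le_exp|exact: nq2_le].
  by rewrite mulr_ge0 // exprn_ge0 // ltW // q_gt0.
by rewrite -expRD ler_expR; lra.
Qed.

Lemma n_predR : n.-1%:R = n%:R - 1 :> R.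
Proof.
have n1 : (0 < n)%N by rewrite -(ltr0n R); have := n_large; lra.
by rewrite -[in RHS](prednK n1) -natr1 addrK.
Qed.

Lemma edges_large : 100 * 100 * 100 <= 'C(n, 2)%:R * q.
Proof.
rewrite bin2R; have := nq_large; have := n_large; set N : R := n%:R.
have := q_gt0; nra.
Qed.

Lemma janson_le (a : R) (k : nat) : 0 <= a -> a <= 2 ->
  janson_base 'I_n (a * q) ^+ k <=
    expR (- (k%:R * ((1 - 3 * a ^+ 2 * (n%:R * q ^+ 2)) * (a ^+ 3 * q ^+ 3)))).
Proof.
move=> a0 a2; have h := nq2_small; have q0 := q_gt0; have qs := q_small.
have -> : (1 - 3 * a ^+ 2 * (n%:R * q ^+ 2)) * (a ^+ 3 * q ^+ 3) =
  (1 - 3 * #|'I_n|%:R * (a * q) ^+ 2) * (a * q) ^+ 3 by rewrite card_ord; ring.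
apply: onem_exp_le; rewrite card_ord.
set s := 3 * _ * _; have s0 : 0 <= s by apply: mulr_ge0; [apply: mulr_ge0|apply: sqr_ge0].
have aq : 0 <= a * q <= 1 by apply/andP; split; nra.
move/andP: aq => [aq0 aq1].
have c1 : (a * q) ^+ 3 <= 1 by rewrite exprn_ile1.
have c0 : 0 <= (a * q) ^+ 3 by rewrite exprn_ge0.
nra.
Qed.

Lemma nq_le1 (a : R) : 0 <= a -> a <= 2 -> 3 * #|'I_n|%:R * (a * q) ^+ 2 <= 1.
Proof.
move=> a0 a2; rewrite card_ord; have := nq2_small.
have -> : 3 * n%:R * (a * q) ^+ 2 = 3 * a ^+ 2 * (n%:R * q ^+ 2) by ring.
have : 0 <= n%:R * q ^+ 2 by rewrite mulr_ge0 ?sqr_ge0.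
have a4 : a ^+ 2 <= 4 by nra.
have a40 : 0 <= a ^+ 2 by rewrite sqr_ge0.
set s := n%:R * _; move=> s0 sl; nra.
Qed.

Lemma aq_bounds (a : R) : 0 <= a -> a <= 2 -> 0 <= a * q /\ a * q <= 1.
Proof. by move=> a0 a2; have := q_gt0; have := q_small; split; nra. Qed.

Let W (a : R) : edge 'I_n -> R := fun=> a * q.

(** First moment: as (3/2)^3 / 2 = 27/16, the bound is about n^(1 - 27/16), with room to spare. *)
Lemma prob_not_all_in_triangle_small :
  prob (W (3 / 2)) (fun w => ~~ `[< all_in_triangle w >]) <= expR (- (1 / 2 * L)).
Proof.
have a0 : 0 <= 3 / 2 :> R by lra.
have a2 : 3 / 2 <= 2 :> R by lra.
have [p0 p1] := aq_bounds a0 a2.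
have := @prob_not_all_in_triangle R _ _ id (W (3 / 2)) _ (fun=> p0) (fun=> p1) (@inj_id _)
  (fun=> erefl) p0 p1 (nq_le1 a0 a2).
rewrite (@eq_prob _ _ _ _ (fun w => ~~ `[< all_in_triangle w >])); last first.
  by move=> w; rewrite preimset_id.
move=> /le_trans; apply; rewrite card_ord.
apply: le_trans (ler_wpM2l (ler0n _ n) (janson_le 'C(n.-1, 2) a0 a2)) _.
rewrite {1}natE -expRD ler_expR bin2R n_predR.
have := q3n2; have := nq2_small; have := n_large; have := L_large; have := q_gt0.
have : 0 <= n%:R * q ^+ 2 by rewrite mulr_ge0 ?sqr_ge0.
set N : R := n%:R; set s := N * q ^+ 2; set c := q ^+ 3 => s0 q0 Ll Nl sl cN.
have c0 : 0 <= c by rewrite exprn_ge0 // ltW.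
have M : 49 / 100 * L <= (N - 1) * (N - 1 - 1) / 2 * c.
  rewrite -cN; have : 49 / 100 * N ^+ 2 <= (N - 1) * (N - 1 - 1) / 2 by nra.
  by move=> h; nra.
set M' := (N - 1) * (N - 1 - 1) / 2 * c in M.
have -> : (N - 1) * (N - 1 - 1) / 2 * ((1 - 3 * (3 / 2) ^+ 2 * s) * ((3 / 2) ^+ 3 * c)) =
   (1 - 3 * (3 / 2) ^+ 2 * s) * ((3 / 2) ^+ 3) * M' by rewrite /M'; ring.
have : 99 / 100 * (27 / 8) * M' <= (1 - 3 * (3 / 2) ^+ 2 * s) * ((3 / 2) ^+ 3) * M' by nra.
lra.
Qed.

End Threshold.

Section Threshold.
Variables (R : realType) (n : nat).
Let L : R := ln n%:R.
Hypothesis L_large : 100 * 100 <= L.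
Notation q := (scale R n).
Let W (a : R) : edge 'I_n -> R := fun=> a * q.

(** As (5/4)^3 / 2 = 125/128, about n^(3/128) vertices are expected to be uncovered, more than
    n^(1/50). The two summands are bounds for [l^-1] and for the excess of the pair probabilities
    relative to [l ^+ 2]. *)
Lemma prob_all_in_triangle_small :
  prob (W (5 / 4)) (fun w => `[< all_in_triangle w >]) <=
    expR (- (1 / 50 * L)) + 40 * expR (- (1 / 10 * L)).
Proof.
have a0 : 0 <= 5 / 4 :> R by lra.
have a2 : 5 / 4 <= 2 :> R by lra.
have [p0 p1] := aq_bounds L_large a0 a2.
have := @prob_all_in_triangle R _ _ id (W (5 / 4)) _ (fun=> p0) (fun=> p1) (@inj_id _)
  (fun=> erefl) p0 p1 (nq_le1 L_large a0 a2).
rewrite (@eq_prob _ _ _ _ (fun w => `[< all_in_triangle w >])); last first.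
  by move=> w; rewrite preimset_id.
rewrite card_ord /=.
have nE := natE L_large; have n0 : 0 < n%:R :> R by rewrite nE expR_gt0.
have q0 := q_gt0 R n; have qs := q_small L_large; have Nl := n_large L_large.
have cN := q3n2 L_large; have Lnq := Lnq2_le L_large; have nq := nq2_small L_large.
rewrite -/L in cN Lnq.
set M := 'C(n.-1, 2); set P := prob _ _; set y := (5 / 4 * q) ^+ 3.
set s := n%:R * q ^+ 2 in Lnq nq.
have s0 : 0 <= s by rewrite mulr_ge0 ?sqr_ge0 // ltW.
have yE : y = 125 / 64 * q ^+ 3 by rewrite /y; field.
have y0 : 0 <= y by rewrite exprn_ge0.
have q2 : q ^+ 2 <= 2^-1 by nra.
have yq : y <= q by rewrite yE; nra.
have M0 : 0 <= M%:R :> R by [].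
have MR : M%:R <= n%:R ^+ 2 / 2 :> R by rewrite /M bin2R (n_predR L_large); nra.
have My : M%:R * y <= 125 / 128 * L.
  rewrite yE -cN; have c0 : 0 <= q ^+ 3 by rewrite exprn_ge0 // ltW.
  move: (ler_wpM2r c0 MR); lra.
have My0 : 0 <= M%:R * y by rewrite mulr_ge0.
pose l := n%:R * (1 - y) ^+ M.
have exp_ge : expR (- (M%:R * (y + 2 * y ^+ 2))) <= (1 - y) ^+ M.
  by apply: onem_exp_ge => //; lra.
have l_ge : expR (1 / 50 * L) <= l.
  apply: (@le_trans _ _ (n%:R * expR (- (M%:R * (y + 2 * y ^+ 2))))); last first.
    by rewrite ler_pM2l.
  rewrite nE -expRD ler_expR -/L.
  have : M%:R * y * y <= 125 / 128 * L * (100 * 50)^-1.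
    by apply: ler_pM => //; apply: le_trans yq qs.
  move: L_large; rewrite -/L; lra.
have e1 : 1 <= expR (1 / 50 * L).
  by apply: le_trans (expR_ge1Dx _); move: L_large; rewrite -/L; lra.
have l1 : 1 <= l by apply: le_trans l_ge.
rewrite -/l => /(_ l1).
(* 20 collects the errors in the exponent, in units of [L * s]: 2 from the shared triples, 75/8 from
   Janson's correction, 8 from the quadratic term of [onem_exp_ge]. *)
set b := _ ^+ (2 * M - n); set z := 20 * expR (- (1 / 10 * L)).
have b_le : n%:R ^+ 2 * b <= l ^+ 2 * expR z.
  have -> : l ^+ 2 = n%:R ^+ 2 * ((1 - y) ^+ M) ^+ 2 by rewrite exprMn.
  rewrite -mulrA ler_pM2l ?exprn_gt0 //.
  apply: le_trans (janson_le L_large _ a0 a2) _.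
  apply: (@le_trans _ _ (expR (- (M%:R * (y + 2 * y ^+ 2))) ^+ 2 * expR z)); last first.
    by rewrite ler_pM2r ?expR_gt0 // lerXn2r ?nnegrE ?expR_ge0 // (le_trans _ exp_ge) ?expR_ge0.
  rewrite -expRM_natl -expRD ler_expR -/s.
  have -> : (5 / 4) ^+ 3 * q ^+ 3 = y by rewrite yE; field.
  have k_ge : 2 * M%:R - n%:R <= (2 * M - n)%:R :> R.
    have h : (2 * M <= 2 * M - n + n)%N by rewrite addnC -leq_subLR.
    by rewrite -(ler_nat R) natrD natrM in h; rewrite lerBlDr.
  have d0 : 0 <= (1 - 3 * (5 / 4) ^+ 2 * s) * y by rewrite mulr_ge0 //; lra.
  have h1 := ler_wpM2r d0 k_ge.
  have ny : n%:R * y <= 2 * s.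
    rewrite yE /s; have : n%:R * q ^+ 2 * q <= n%:R * q ^+ 2 * 1 by rewrite ler_wpM2l //; lra.
    rewrite mulr1; have -> : n%:R * (125 / 64 * q ^+ 3) = 125 / 64 * (n%:R * q ^+ 2 * q) by ring.
    rewrite -/s => ?; lra.
  have ys : y <= 2 * s by apply: le_trans ny; rewrite ler_peMl //; lra.
  have h2 : M%:R * y * y <= L * (2 * s).
    by apply: ler_pM => //; move: L_large; rewrite -/L; lra.
  have h3 : M%:R * y * s <= L * s.
    by apply: ler_pM => //; move: L_large; rewrite -/L; lra.
  have h4 : 0 <= n%:R * y * s by rewrite mulr_ge0 // mulr_ge0 // ltW.
  have h5 : s <= L * s.
    by rewrite ler_peMl //; apply: le_trans L_large; lra.
  rewrite /z; move: h1 Lnq.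
  have -> : (2 * M%:R - n%:R) * ((1 - 3 * (5 / 4) ^+ 2 * s) * y) =
    2 * (M%:R * y) - n%:R * y - (75 / 16) * (2 * (M%:R * y * s) - n%:R * y * s) by field.
  rewrite -/L -/s.
  have -> : 2%:R * (- (M%:R * (y + 2 * y ^+ 2))) = - (2 * (M%:R * y) + 4 * (M%:R * y * y)) by ring.
  lra.
have z2 : z <= 2^-1.
  have : expR (- (1 / 10 * L)) <= (50 : R)^-1.
    by apply: (@expRN_le R n _ _); move: L_large; rewrite -/L; lra.
  by rewrite /z; lra.
have z0 : 0 <= z by rewrite mulr_ge0 ?expR_ge0.
have ez := expR_sub1_le z0 z2.
move=> main; have l0 : 0 < l by apply: lt_le_trans l1.
have l20 : 0 < l ^+ 2 by rewrite exprn_gt0.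
have Pl : P <= l^-1 + (expR z - 1).
  rewrite -(ler_pM2r l20) mulrDl; apply: le_trans main _.
  have -> : l^-1 * l ^+ 2 = l by rewrite expr2 mulrA mulVf ?mul1r // gt_eqF.
  by rewrite mulrBl mul1r [expR z * _]mulrC; lra.
apply: (le_trans Pl); apply: lerD.
  by rewrite expRN lef_pV2 ?posrE ?expR_gt0.
by apply: le_trans ez _; rewrite /z; lra.
Qed.

Lemma div400_ge : n%:R <= 800 * (n %/ 400)%:R :> R.
Proof.
have n_ge : (100 * 100 <= n)%N by rewrite -(ler_nat R) natrM; apply: n_large.
rewrite -natrM ler_nat; have := divn_eq n 400; have := ltn_pmod n (isT : 0 < 400)%N.
by move: (n %/ 400)%N (n %% 400)%N => m r; lia.
Qed.

Lemma prob_not_joined_small :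
  prob (W (31 / 25)) (fun w => ~~ joined w (n %/ 400)) <= expR (- (1 * L)).
Proof.
have a0 : 0 <= 31 / 25 :> R by lra.
have a2 : 31 / 25 <= 2 :> R by lra.
have [p0 p1] := aq_bounds L_large a0 a2.
have := div400_ge; move: (n %/ 400)%N => m mR.
have := @prob_not_joined R _ _ id (W (31 / 25)) _ (fun=> p0) (fun=> p1) (@inj_id _)
  (fun=> erefl) p0 p1 m.
rewrite (@eq_prob _ _ _ _ (fun w => ~~ joined w m)); last by move=> w; rewrite preimset_id.
move=> /le_trans; apply; rewrite card_ord.
have Nl := n_large L_large; have nq := nq_large L_large; have q0 := q_gt0 R n.
have nE := natE L_large.
apply: le_trans (ler_wpM2l _ (onem_exp_le _ p1)) _; first by rewrite exprn_ge0.
have e4 : 4 <= expR 2 :> R.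
  by apply: le_trans (@expR_ge_sqr R 2 (ler0n _ _)); lra.
apply: (@le_trans _ _ (expR 2 ^+ n * expR (- ((m ^ 2)%:R * (31 / 25 * q))))).
  by rewrite ler_pM2r ?expR_gt0 // lerXn2r ?nnegrE ?expR_ge0.
rewrite -expRM_natl -expRD ler_expR natrX.
have LN : L <= n%:R by have := expR_ge1Dx L; rewrite nE /L; lra.
have mm : n%:R ^+ 2 <= 800 * 800 * m%:R ^+ 2 :> R.
  by have m0 : 0 <= m%:R :> R by []; have n0 : 0 <= n%:R :> R by []; nra.
(* The exponent must beat [2 * n], from [4 <= expR 2], and a further [n] for [L]; the constant of
   [nq_large] is sized for this. *)
have : n%:R * (100 * 100 * 200) <= 800 * 800 * (m%:R ^+ 2 * q).
  apply: (@le_trans _ _ (n%:R * (n%:R * q))); first by rewrite ler_wpM2l.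
  have h := ler_wpM2r (ltW q0) mm; move: h; lra.
lra.
Qed.

(** (31/25)^3 / 2 is about 0.953; the loss from [k] up to n / 100 and Janson's correction still
    leave 23/25. *)
Lemma janson_bad_le (k : nat) : 100 * k%:R <= n%:R :> R ->
  janson_base 'I_n (31 / 25 * q) ^+ 'C(n - k, 2) <= expR (- (23 / 25 * L)).
Proof.
move=> kn; have a0 : 0 <= 31 / 25 :> R by lra.
have a2 : 31 / 25 <= 2 :> R by lra.
have Nl := n_large L_large; have kR_ge0 : 0 <= k%:R :> R by exact: ler0n.
have k_le_n : (k <= n)%N by rewrite -(ler_nat R); lra.
apply: le_trans (janson_le L_large _ a0 a2) _.
rewrite ler_expR lerN2 bin2R natrB // -/L.
have bin_ge : 489 / 1000 * n%:R ^+ 2 <= (n%:R - k%:R) * (n%:R - k%:R - 1) / 2 :> R.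
  have f1 : 99 / 100 * n%:R <= n%:R - k%:R :> R by lra.
  have f2 : 989 / 1000 * n%:R <= n%:R - k%:R - 1 :> R by lra.
  have g1 : 0 <= 99 / 100 * n%:R :> R by lra.
  have g2 : 0 <= 989 / 1000 * n%:R :> R by lra.
  by have := ler_pM g1 g2 f1 f2; have := sqr_ge0 (n%:R : R); lra.
have cN := q3n2 L_large; have nq := nq2_small L_large; have q0 := q_gt0 R n.
have c0 : 0 <= q ^+ 3 by rewrite exprn_ge0 // ltW.
have s0 : 0 <= n%:R * q ^+ 2 by rewrite mulr_ge0 ?sqr_ge0.
have h := ler_wpM2r c0 bin_ge.
set B := (n%:R - k%:R) * _ / 2 in h *.
have hB : 489 / 1000 * L <= B * q ^+ 3 by rewrite -/L in cN; lra.
have -> : B * ((1 - 3 * (31 / 25) ^+ 2 * (n%:R * q ^+ 2)) * ((31 / 25) ^+ 3 * q ^+ 3)) =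
  (1 - 3 * (31 / 25) ^+ 2 * (n%:R * q ^+ 2)) * (31 / 25) ^+ 3 * (B * q ^+ 3) by ring.
set s := n%:R * q ^+ 2 in s0 nq *; set B' := B * q ^+ 3 in hB *.
have L0 : 0 <= L by move: L_large; rewrite -/L; lra.
apply: le_trans (_ : (1 - 3 * (31 / 25) ^+ 2 * (100 * 10)^-1) * (31 / 25) ^+ 3 * B' <= _).
  by move: hB L0; lra.
by rewrite ler_wpM2r ?ler_wpM2r //; move: nq hB L0; lra.
Qed.

(* For |U| = k <= n ^ (1 / 8) the edges inside U pay for the choice of U; for
   larger k the bound (4 n / k) ^ k on the binomial coefficient suffices. *)
Lemma prob_bad_set_small :
  prob (round_weight (31 / 25 * q) (2 * q)) (fun w : {set (edge 'I_n + edge 'I_n)} =>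
    bad_set (4 * (n %/ 400)) (round1 w) (rounds w)) <= 8 * expR (- (9 / 200 * L)).
Proof.
have a0 : 0 <= 31 / 25 :> R by lra.
have a2 : 31 / 25 <= 2 :> R by lra.
have [p0 _] := aq_bounds L_large a0 a2.
have [p30 p31] := aq_bounds L_large (ler0n _ 2 : 0 <= 2 :> R) (lexx _).
have q0 := q_gt0 R n.
(* Per vertex of [U], both ranges of [k] end at the same exponent, 1 - 1/8 - 23/25 = 7/8 - 23/25 = -
   9/200. The 4 comes from [bin_le_pow]. *)
pose x := 4 * expR (- (9 / 200 * L)).
have -> : 8 * expR (- (9 / 200 * L)) = 2 * x by rewrite /x; ring.
have x0 : 0 <= x by rewrite mulr_ge0 ?expR_ge0.
have x2 : x <= 2^-1.
  have : expR (- (9 / 200 * L)) <= (8 : R)^-1.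
    by apply: (@expRN_le R n _ _); move: L_large; rewrite -/L; lra.
  by rewrite /x; lra.
apply: prob_bad_set => //; first by rewrite ler_pM2r //; lra.
  exact: (nq_le1 L_large).
move=> k /andP[k0 kK]; rewrite card_ord.
have nE := natE L_large.
have kn : 100 * k%:R <= n%:R :> R.
  rewrite -natrM ler_nat; apply: leq_trans (leq_trunc_div n 400).
  by apply: leq_trans (leq_mul (leqnn 100) kK) _; rewrite mulnA mulnC.
have JE := janson_bad_le kn; set E : R := expR (- (23 / 25 * L)) in JE.
have J0 : 0 <= janson_base 'I_n (31 / 25 * q) ^+ 'C(n - k, 2).
  rewrite exprn_ge0 //; apply: janson_base_ge0 => //; last exact: nq_le1.
  by have [] := aq_bounds L_large a0 a2.
have E0 : 0 <= E by apply: expR_ge0.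
rewrite mulnC exprM.
have JEk : (janson_base 'I_n (31 / 25 * q) ^+ 'C(n - k, 2)) ^+ k <= E ^+ k.
  by rewrite lerXn2r ?nnegrE.
have J0k : 0 <= (janson_base 'I_n (31 / 25 * q) ^+ 'C(n - k, 2)) ^+ k by rewrite exprn_ge0.
have kk0 : 0 <= k%:R ^+ 2 * (2 * q) by rewrite mulr_ge0 ?sqr_ge0.
have min0 : 0 <= Num.min ((k%:R ^+ 2 * (2 * q)) ^+ uphalf k) 1.
  by rewrite le_min ler01 exprn_ge0.
have [kL|kL] := lerP k%:R (expR (1 / 8 * L)).
  set z : R := expR (- (1 / 8 * L)).
  have z0 : 0 <= z by apply: expR_ge0.
  have z1 : z <= 1 by rewrite -expR0 ler_expR; move: L_large; rewrite -/L; lra.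
  (* Exponents: 2/8 + 1/10 - 3/5 = - 1/4, where 1/10 absorbs the factor 2. *)
  have kz : k%:R ^+ 2 * (2 * q) <= z ^+ 2.
    apply: (@le_trans _ _ (expR (1 / 8 * L) ^+ 2 * (expR (1 / 10 * L) * expR (- (3 / 5 * L))))).
      apply: ler_pM; rewrite ?sqr_ge0 //.
        by rewrite lerXn2r ?nnegrE ?expR_ge0.
      apply: ler_pM => //; [exact: ltW| |exact: (q_le L_large)].
      by apply: le_trans (expR_ge1Dx _); move: L_large; rewrite -/L; lra.
    rewrite -!expRM_natl -!expRD ler_expR; move: L_large; rewrite -/L; lra.
  have min_le : Num.min ((k%:R ^+ 2 * (2 * q)) ^+ uphalf k) 1 <= z ^+ k.
    rewrite ge_min; apply/orP; left.
    apply: (@le_trans _ _ ((z ^+ 2) ^+ uphalf k)); first by rewrite lerXn2r ?nnegrE ?sqr_ge0.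
    by rewrite -exprM; apply: ler_wiXn2l => //; rewrite mul2n -leq_uphalf_double.
  apply: (@le_trans _ _ (n%:R ^+ k * (z ^+ k * E ^+ k))).
    apply: ler_pM => //; [exact: mulr_ge0| |exact: ler_pM].
    by rewrite -natrX ler_nat bin_leq_exp.
  have step : n%:R * (z * E) <= x.
    rewrite nE /z /E -!expRD /x; apply: (@le_trans _ _ (expR (- (9 / 200 * L)))).
      by rewrite ler_expR -/L; lra.
    by rewrite ler_peMl ?expR_ge0 //; lra.
  by rewrite -!exprMn; apply: lerXn2r step; rewrite nnegrE // mulr_ge0 // mulr_ge0.
apply: (@le_trans _ _ ((4 * (n%:R / k%:R)) ^+ k * (1 * E ^+ k))).
  apply: ler_pM => //; [exact: mulr_ge0|exact: bin_le_pow|].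
  by apply: ler_pM => //; rewrite ge_min lexx orbT.
have kR0 : 0 < k%:R :> R by rewrite ltr0n.
have nk : n%:R / k%:R <= expR (7 / 8 * L).
  rewrite ler_pdivrMr //; apply: (@le_trans _ _ (expR (7 / 8 * L) * expR (1 / 8 * L))).
    by rewrite nE -expRD ler_expR -/L; lra.
  by rewrite ler_wpM2l ?expR_ge0 // ltW.
have nk0 : 0 <= n%:R / k%:R :> R by rewrite divr_ge0.
have step : 4 * (n%:R / k%:R) * E <= x.
  rewrite /x -mulrA ler_wpM2l //.
  apply: (@le_trans _ _ (expR (7 / 8 * L) * E)); first by rewrite ler_wpM2r.
  by rewrite /E -expRD ler_expR; lra.
by rewrite mul1r -exprMn; apply: lerXn2r step; rewrite nnegrE // mulr_ge0 // mulr_ge0.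
Qed.

End Threshold.

(** * Conclusion *)

Section Assembly.
Variables (R : realType) (n : nat).
Let L : R := ln n%:R.
Hypothesis L_large : 100 * 100 <= L.

(* The densities [a * q] used here have a ^ 3 / 2 close to 1 from below for
   a = 31 / 25 < 5 / 4, around the time t, and a ^ 3 / 2 > 1 for a = 3 / 2 < 2,
   around the time u. *)
Lemma Pr_tau_neq_small :
  1 - Pr R (fun w : outcome n => tau_NAC w == tau_triangle w) <=
  102 * expR (- (1 / 50 * L)).
Proof.
have Nq := edges_large L_large; have q0 := q_gt0 R n; have qs := q_small L_large.
have n_ge : (100 * 100 <= n)%N by rewrite -(ler_nat R) natrM; apply: n_large.
set q := scale R n in Nq q0 qs; set N := 'C(n, 2) in Nq; set X := N%:R * q in Nq.
(* 249/200 is midway between the densities 31/25 and 5/4, and 7/4 is midway between 3/2 and 2. *)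
pose t := Num.truncn (249 / 200 * X); pose u := Num.truncn (7 / 4 * X).
have X0 : 0 <= X by lra.
have tX : 0 <= 249 / 200 * X by lra.
have uX : 0 <= 7 / 4 * X by lra.
have := truncn_itv tX; have := truncn_itv uX.
rewrite -/t -/u -[t.+1%:R]natr1 -[u.+1%:R]natr1 => /andP[u1 u2] /andP[t1 t2].
(* This fits, rounding included, into the gap [X / 200] on either side of [t], and Chebyshev's
   condition that [d ^+ 2] be at least [8 * X] holds once [X] reaches 500000. *)
pose d := X / 250.
have d0 : 0 < d by rewrite /d; lra.
have dX (a : R) : 0 <= a -> a <= 2 -> 4 * (N%:R * (a * q)) <= d ^+ 2.
  move=> a0 a2; have -> : N%:R * (a * q) = a * X by rewrite /X; ring.
  have aX : a * X <= 2 * X by rewrite ler_wpM2r.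
  have XX : 100 * 100 * 100 * X <= X * X by rewrite ler_wpM2r.
  by rewrite /d; lra.
have bounds (a : R) : 0 <= a -> a <= 2 -> 0 <= a * q <= 1.
  by move=> a0 a2; have [h1 h2] := aq_bounds L_large a0 a2; apply/andP.
have NX (a : R) : N%:R * (a * q) = a * X by rewrite /X; ring.
have uN : (u <= N)%N.
  rewrite -(ler_nat R); apply: le_trans u1 _; rewrite /X.
  have -> : 7 / 4 * (N%:R * q) = N%:R * (7 / 4 * q) by ring.
  by rewrite ler_piMr //; lra.
have mono (B B' : {set edge 'I_n}) :
    B \subset B' -> `[< all_in_triangle B >] -> `[< all_in_triangle B' >].
  by move=> BB /asboolP At; apply/asboolP; apply: all_in_triangle_mono At.
have Pa : Pr R (fun w : outcome n => `[< all_in_triangle (process w t) >]) <=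
    2 * (expR (- (1 / 50 * L)) + 40 * expR (- (1 / 10 * L))).
  apply: (@le_trans _ _ (2 * prob (fun=> 5 / 4 * q)
      (fun B : {set edge 'I_n} => `[< all_in_triangle B >]))).
    apply: (@Pr_monotone_le R n (fun B => `[< all_in_triangle B >]) _ d) => //.
    - by apply: bounds; lra.
    - by apply: dX; lra.
    - by rewrite NX /d; lra.
  by rewrite ler_pM2l //; apply: prob_all_in_triangle_small.
have Pe : Pr R (fun w : outcome n => ~~ `[< all_in_triangle (process w u) >]) <=
    2 * expR (- (1 / 2 * L)).
  apply: (@le_trans _ _ (2 * prob (fun=> 3 / 2 * q)
      (fun B : {set edge 'I_n} => ~~ `[< all_in_triangle B >]))).
    apply: (@Pr_antitone_le R n (fun B => ~~ `[< all_in_triangle B >]) _ d) => //.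
    - by apply: bounds; lra.
    - by apply: dX; lra.
    - by rewrite NX /d; lra.
    - by move=> B B' BB; apply: contra; apply: mono.
  by rewrite ler_pM2l //; apply: prob_not_all_in_triangle_small.
have Pc : Pr R (fun w : outcome n => ~~ joined (process w t) (n %/ 400)) <=
    2 * expR (- (1 * L)).
  apply: (@le_trans _ _ (2 * prob (fun=> 31 / 25 * q)
      (fun B : {set edge 'I_n} => ~~ joined B (n %/ 400)))).
    apply: (@Pr_antitone_le R n (fun B => ~~ joined B (n %/ 400)) _ d) => //.
    - by apply: bounds; lra.
    - by apply: dX; lra.
    - by rewrite NX /d; lra.
    - by move=> B B' BB; apply: contra; apply: joined_mono.
  by rewrite ler_pM2l //; apply: prob_not_joined_small.
have Pb : Pr R (fun w : outcome n => bad_set (4 * (n %/ 400)) (process w t) (process w u)) <=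
    2 * (8 * expR (- (9 / 200 * L))).
  apply: (@le_trans _ _ (2 * prob (round_weight (31 / 25 * q) (2 * q))
    (fun w : {set (edge 'I_n + edge 'I_n)} =>
       bad_set (4 * (n %/ 400)) (round1 w) (rounds w)))).
    apply: (@Pr_two_times_le R n (bad_set (4 * (n %/ 400))) _ _ d) => //.
    - by apply: mulr_ge0; lra.
    - by rewrite ler_pM2r //; lra.
    - lra.
    - by apply: dX; lra.
    - by rewrite NX /d; lra.
    - by rewrite NX /d; lra.
    - by move=> B B' D D' BB DD; apply: bad_set_mono.
  by rewrite ler_pM2l //; apply: prob_bad_set_small.
have n3 : (2 < n)%N by apply: leq_trans n_ge.
have m0 : (0 < n %/ 400)%N by rewrite divn_gt0 //; apply: leq_trans n_ge.
have m2 : (2 * (n %/ 400) <= n)%N.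
  by apply: leq_trans (leq_trunc_div n 400); rewrite mulnC leq_mul2l orbT.
apply: le_trans (Pr_tau_neq R t n3 m0 m2 uN) _.
have exp_le (a : R) : 1 / 50 <= a -> expR (- (a * L)) <= expR (- (1 / 50 * L)).
  move=> a50; rewrite ler_expR lerN2 ler_wpM2r //.
  by move: L_large; rewrite -/L; lra.
have e1 : expR (- (1 / 10 * L)) <= expR (- (1 / 50 * L)) by apply: exp_le; lra.
have e2 : expR (- (1 / 2 * L)) <= expR (- (1 / 50 * L)) by apply: exp_le; lra.
have e3 : expR (- (1 * L)) <= expR (- (1 / 50 * L)) by apply: exp_le; lra.
have e4 : expR (- (9 / 200 * L)) <= expR (- (1 / 50 * L)) by apply: exp_le; lra.
(* The constant is 2 (1 + 40) + 2 + 2 + 16 = 102. *)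
by apply: le_trans (lerD Pa (lerD Pe (lerD Pc Pb))) _; lra.
Qed.

End Assembly.

From mathcomp Require Import classical_sets topology normedtype.
Import numFieldNormedType.Exports.
Local Open Scope classical_set_scope.

Theorem theorem4p1 (R : realType) :
  (fun n : nat =>
     Pr R (fun w : outcome n => tau_NAC w == tau_triangle w))
    @ \oo --> (1 : R).
Proof.
apply/cvgrPdist_le => e e0.
(* The first term makes n large enough for the estimates; the second brings 102 n^(- 1/50) below
   [e]. *)
pose B : R := Num.max (expR (100 * 100)) (expR (50 * ln (102 / e))).
have := nbhs_infty_ger B; apply: filterS => n Bn.
have n0 : 0 < n%:R :> R.
  by apply: lt_le_trans Bn; rewrite lt_max expR_gt0.
have L_ge c : expR c <= B -> c <= ln n%:R.
  by move=> cB; rewrite -ler_expR lnK ?posrE //; apply: le_trans Bn.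
have L1 : 100 * 100 <= ln n%:R :> R by apply: L_ge; rewrite le_max lexx.
have L2 : 50 * ln (102 / e) <= ln n%:R by apply: L_ge; rewrite le_max lexx orbT.
rewrite ger0_norm; last by rewrite -PrC Pr_ge0.
apply: le_trans (Pr_tau_neq_small L1) _.
have e102 : 0 < 102 / e by rewrite divr_gt0.
have -> : e = 102 * (102 / e)^-1 by rewrite invf_div mulrCA divff ?mulr1 // pnatr_eq0.
rewrite ler_pM2l // -[leRHS]lnK ?posrE ?invr_gt0 // ler_expR lnV ?posrE //.
by lra.
Qed.
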